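(* For every $\theta\in\mathbb R$, \[\limsup_{n\to\infty}\sqrt{\frac{n}{\log\log n}}\,(\hat\theta_n-\theta)=\sqrt{\frac{2(m+1)}{m(2m-1)}}\quad P\text{-a.s.}\]
   Context: Fix $m>1/2$. Let $c_m:=\left(\int_{\mathbb R}(1+x^2)^{-m}\,dx\right)^{-1}$ and $f(x):=c_m(1+x^2)^{-m}$. For $\theta\in\mathbb R$, $\mathrm{PVII}_m(\theta,1)$ denotes the Pearson Type VII distribution with location $\theta$ and scale $1$, i.e. the law with density $x\mapsto f(x-\theta)$. Let $(X_n)_{n\ge1}$ be i.i.d. random variables on a probability space $(\Omega,\mathcal F,P)$ with law $\mathrm{PVII}_m(\theta,1)$. For each $n$, let $\hat\theta_n(x_1,\dots,x_n)$ be any Borel measurable function on $\mathbb R^n$ such that $\hat\theta_n(x_1,\dots,x_n)$ is a maximizer of $t\mapsto\prod_{i=1}^n f(x_i-t)$ over $t\in\mathbb R$, and let $\hat\theta_n:=\hat\theta_n(X_1,\dots,X_n)$ (the maximum likelihood estimator). *)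

(* Defs.v *)
From HB Require Import structures.
From mathcomp Require Import all_boot all_order all_algebra.
From mathcomp Require Import all_classical all_reals all_analysis.
Set Implicit Arguments. Unset Strict Implicit. Unset Printing Implicit Defensive.
Import Order.TTheory GRing.Theory Num.Theory.
Import numFieldNormedType.Exports.
Local Open Scope classical_set_scope.
Local Open Scope ring_scope.

Section PVII.
Variable R : realType.

Definition pvii_const (m : R) : R :=
  (fine (\int[@lebesgue_measure R]_x ((1 + x ^+ 2) `^ (- m))%:E))^-1.

Definition pvii_density (m : R) (x : R) : R :=
  pvii_const m * (1 + x ^+ 2) `^ (- m).

Definition has_pvii_law d (T : measurableType d) (P : probability T R)
    (m theta : R) (Y : T -> R) : Prop :=
  forall A : set R, measurable A ->
    P (Y @^-1` A) = (\int[@lebesgue_measure R]_(x in A) (pvii_density m (x - theta))%:E)%E.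

Definition mutually_independent d (T : measurableType d) (P : probability T R)
    (X : nat -> T -> R) : Prop :=
  forall (s : seq nat) (A : nat -> set R), uniq s ->
    (forall i, measurable (A i)) ->
    P (\bigcap_(i in [set` s]) (X i @^-1` A i)) =
      (\prod_(i <- s) P (X i @^-1` A i))%E.

Definition pvii_likelihood (m : R) n (x : n.-tuple R) (t : R) : R :=
  \prod_(i < n) pvii_density m (tnth x i - t).

End PVII.

(* Main.v *)
(**
 Write [Y_i = X_i - theta] and [phi y = y / (1 + y^2)], so that [2 m phi] is the
 score of the Pearson density.

 Law of the iterated logarithm for a bounded centred [psi(X_i)]: small-parameter
 bounds on the moment generating function give, through the walk stopped at its
 first passage, an exponential maximal inequality, hence the upper half along
 geometric blocks.  For the lower half, [E exp(t D)] over a block sum [D] is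
 carried by [D] close to its tilted mean, because both tails are negligible by
 the same upper bounds; this yields a lower bound for [P (D >= x)] that remains
 valid conditionally on the past, so infinitely many blocks are large almost
 surely.  The upper half also provides the strong law for bounded functions.

 Moments come from the Stein identity [E (r'(Y) - 2 m phi(Y) r(Y)) = 0] with
 [r = 1, y, phi].  Consistency of the maximizer: for large [t] the log-likelihood
 ratio is controlled by the observations in a fixed interval, and on compact sets
 one combines Lipschitz continuity, the strong law on a finite grid, and
 positivity of the Kullback-Leibler divergence.  Finally, a second-order
 expansion of the score equation at the maximizer transfers the law of the
 iterated logarithm from the score to the estimator.
*)

Require Import Defs.
From HB Require Import structures.
From mathcomp Require Import all_boot all_order all_algebra.
From mathcomp Require Import all_classical all_reals all_analysis.
From mathcomp Require Import measurable_realfun.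
From mathcomp Require Import ring lra.
Set Implicit Arguments. Unset Strict Implicit. Unset Printing Implicit Defensive.
Import Order.TTheory GRing.Theory Num.Theory.
Import numFieldNormedType.Exports.
Local Open Scope classical_set_scope.
Local Open Scope ring_scope.

(** * Independence of the past *)

(** For $m$ close to $1/2$ the observations need not even have a mean. A theory of bounded summands
    nevertheless suffices: [pphi] and [dpphi] are bounded by 1, and the log-likelihood ratio
    [log_ratio t] by [ln (2 * pq t)] through Peetre's inequality, although each log-density is
    unbounded. Exponential moments thus come for free, and the bounded law of the iterated logarithm
    serves for the score, for its slope and for consistency.

    The lower half must hold conditionally on the past, yet no conditional expectation is formed:
    inequalities are multiplied by the indicator of an arbitrary past event and integrated.

    The constant comes from $V = E\,\phi(Y)^2$ and the mean slope $J = E\,\phi'(Y) = 2mV$: the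
    estimation error is close to $\sum_i \phi(Y_i)/(nJ)$, whose limsup in the stated scale is
    $\sqrt{2V}/J = 1/(m\sqrt{2V})$. *)

Section independence.
Context (R : realType) (d : measure_display) (Omega : measurableType d)
  (P : probability Omega R) (X : nat -> {RV P >-> R}).
Hypothesis indepX : mutually_independent P (fun i => (X i : Omega -> R)).

(** Cylinders over the first [n] observations. Being closed under intersection, they determine
    finite measures on the sigma-algebra they generate, and mutual independence speaks about them
    directly. *)
Definition past_rectangle (n : nat) : set (set Omega) :=
  [set B | exists2 A : nat -> set R, forall i, measurable (A i) &
    B = \bigcap_(i in [set` iota 0 n]) (X i @^-1` A i)].

(** The sigma-algebra of the first [n] observations, as a measurable type with carrier [Omega]: the
    same function can be typed on [Omega] or on [past n], and measurability on [past n] expresses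
    adaptedness. *)
Definition past (n : nat) := g_sigma_algebraType (past_rectangle n).

Lemma measurable_preX i (A : set R) : measurable A -> measurable (X i @^-1` A).
Proof. by move=> mA; rewrite -[_ @^-1` _]setTI; exact: measurable_funP. Qed.

Lemma past_rectangle_measurable n : past_rectangle n `<=` measurable.
Proof.
move=> _ [A mA ->]; rewrite bigcap_seq.
by apply: bigsetI_measurable => i _; exact: measurable_preX.
Qed.

Lemma past_measurable n (B : set (past n)) :
  measurable B -> measurable (B : set Omega).
Proof.
move=> mB; exact: (smallest_sub (@sigma_algebra_measurable _ Omega)
  (@past_rectangle_measurable n)) mB.
Qed.

Lemma past_measurable_id n : measurable_fun setT (id : Omega -> past n).
Proof. by move=> _ B mB; rewrite setTI; exact: (past_measurable mB). Qed.

Lemma past_rectangle_setI n : setI_closed (past_rectangle n).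
Proof.
move=> _ _ [A mA ->] [B mB ->]; exists (fun i => A i `&` B i).
  by move=> i; exact: measurableI.
apply/seteqP; split => [w [Aw Bw] i ni|w ABw].
  by split; [exact: Aw|exact: Bw].
by split => i ni; have [] := ABw i ni.
Qed.

Lemma measurable_past_preX n i (A : set R) : (i < n)%N -> measurable A ->
  measurable (X i @^-1` A : set (past n)).
Proof.
move=> ltin mA; apply: sub_sigma_algebra.
exists (fun j => if j == i then A else setT); first by move=> j; case: ifP.
apply/seteqP; split => [w XiwA j _|w]; rewrite /preimage/=.
  by have [->|//] := eqVneq j i.
move=> /(_ i); rewrite /= eqxx; apply.
by rewrite mem_iota.
Qed.

Lemma measurable_past n i : (i < n)%N ->
  measurable_fun setT (X i : past n -> R).
Proof. by move=> ltin _ A mA; rewrite setTI; exact: measurable_past_preX. Qed.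

Lemma past_leq m n (B : set Omega) : (m <= n)%N ->
  measurable (B : set (past m)) -> measurable (B : set (past n)).
Proof.
move=> lemn; apply: smallest_sub; first exact: (@sigma_algebra_measurable _ (past n)).
move=> _ [A mA ->]; rewrite bigcap_seq big_seq.
apply: (@bigsetI_measurable _ (past n)) => i.
rewrite mem_iota add0n => /andP[_ ltim]; apply: measurable_past_preX => //.
exact: leq_trans lemn.
Qed.

Lemma measurable_fun_past_leq m n d' (T : measurableType d') (g : Omega -> T) :
  (m <= n)%N -> measurable_fun setT (g : past m -> T) ->
  measurable_fun setT (g : past n -> T).
Proof.
move=> lemn mg _ B mB; rewrite setTI; apply: past_leq lemn _.
by rewrite -[X in measurable X]setTI; exact: mg.
Qed.

(** For fixed [C] both sides are finite measures in [B]; they agree on past rectangles, hence on the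
    generated sigma-algebra. *)
Lemma past_indep n (B : set (past n)) (C : set R) : measurable B ->
  measurable C -> P (B `&` (X n @^-1` C)) = (P B * P (X n @^-1` C))%E.
Proof.
move=> mB mC.
have P_fin : P (X n @^-1` C) \is a fin_num.
  by apply: fin_num_measure; exact: measurable_preX.
have p_ge0 : 0 <= fine (P (X n @^-1` C)) by rewrite fine_ge0.
have := @g_sigma_algebra_measure_unique _ R Omega (past_rectangle n)
  (@past_rectangle_measurable n) (fun=> setT) _ _
  (mrestr P (@measurable_preX n C mC)) (mscale (NngNum p_ge0) P)
  (@past_rectangle_setI n) _ _ B mB.
have mscE A : mscale (NngNum p_ge0) P A = (P A * P (X n @^-1` C))%E.
  by rewrite /mscale/= fineK// muleC.
rewrite -mscE; apply.
- by move=> _; exists (fun=> setT) => //; rewrite bigcap_seq big1.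
- by rewrite bigcup_const.
- move=> _ [A mA ->].
  (* Putting the condition [C] on coordinate [n] turns the intersection into a cylinder over [n + 1]
     coordinates, to which independence applies. *)
  pose A' i := if i == n then C else A i.
  have mA' i : measurable (A' i) by rewrite /A'; case: ifP.
  have := @indepX (iota 0 n.+1) A' (iota_uniq _ _) mA'.
  rewrite -addn1 iotaD add0n/= big_cat big_seq1 {3}/A' eqxx => E.
  apply/esym; rewrite [LHS]mscE; apply/esym.
  transitivity (P (\bigcap_(i in [set` iota 0 n ++ [:: n]]) (X i @^-1` A' i))).
    congr (P _); apply/seteqP; split.
      move=> w [Aw Cw] i /=; rewrite mem_cat inE => /orP[|/eqP->].
        rewrite mem_iota /A' add0n => /andP[_ ltin].
        by rewrite /preimage/= ltn_eqF//; apply: Aw; rewrite /= mem_iota.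
      by rewrite /A' /preimage /= eqxx.
    move=> w H; split.
      move=> i /=; rewrite mem_iota => /andP[_ ltin].
      have := H i; rewrite /= mem_cat mem_iota ltin /= /A' /preimage/=.
      by rewrite ltn_eqF//; exact.
    have := H n; rewrite /= mem_cat inE eqxx orbT /A' /preimage /= eqxx; exact.
  rewrite E; congr (_ * _)%E.
  have := @indepX (iota 0 n) A (iota_uniq _ _) mA => ->.
  rewrite [LHS]big_seq [RHS]big_seq; apply: eq_bigr => i.
  by rewrite mem_iota add0n /A' => /andP[_ ltin]; rewrite ltn_eqF.
- by move=> _; rewrite /= /mrestr setTI (le_lt_trans (probability_le1 _ _)) ?ltry//;
    exact: measurable_preX.
Qed.

End independence.

Section independence_integral.
Context (R : realType) (d : measure_display) (Omega : measurableType d)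
  (P : probability Omega R) (X : nat -> {RV P >-> R}).
Hypothesis indepX : mutually_independent P (fun i => (X i : Omega -> R)).

Lemma past_measurable_fun n d' (T : measurableType d') (g : Omega -> T) :
  measurable_fun setT (g : past X n -> T) -> measurable_fun setT g.
Proof.
move=> mg _ B mB; rewrite setTI; apply: (@past_measurable _ _ _ _ X n).
by rewrite -[X in measurable X]setTI; exact: mg.
Qed.

(** The map [w -> (w, X n w)] into [past X n * R] pushes [P] to a product measure, by [past_indep]
    on rectangles; Tonelli then separates the factors. *)
Lemma past_indep_integral n (g : Omega -> R) (h : R -> R) :
  measurable_fun setT (g : past X n -> R) -> measurable_fun setT h ->
  (forall w, 0 <= g w) -> (forall x, 0 <= h x) ->
  (\int[P]_w (g w * h (X n w))%:E =
   \int[P]_w (g w)%:E * \int[P]_w (h (X n w))%:E)%E.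
Proof.
move=> mg mh g0 h0.
pose J0 : Omega -> past X n * R := fun w => (w, X n w).
have mJ : measurable_fun setT J0.
  by apply/measurable_fun_pairP; split => //; exact: past_measurable_id.
pose I0 : Omega -> past X n := id.
have mI : measurable_fun setT I0 by exact: past_measurable_id.
pose J := HB.pack_for {mfun Omega >-> (past X n * R)%type} J0
  (isMeasurableFun.Build _ _ _ _ J0 mJ).
pose I := HB.pack_for {mfun Omega >-> past X n} I0
  (isMeasurableFun.Build _ _ _ _ I0 mI).
pose PJ := distribution P J.
pose PI := distribution P I.
pose PX := distribution P (X n).
have PJE A : measurable A -> (PI \x PX)%E A = PJ A.
  apply: product_measure_unique => B C mB mC.
  rewrite -[RHS](past_indep indepX mB mC).
  by congr (P _); apply/seteqP; split.
have mgh : measurable_fun setT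
    (fun z : past X n * R => (g z.1 * h z.2)%:E).
  apply/measurable_EFinP/measurable_funM.
    by apply: (measurableT_comp mg); exact: measurable_fst.
  by apply: (measurableT_comp mh); exact: measurable_snd.
have mEg : measurable_fun setT (EFin \o g : past X n -> \bar R).
  exact/measurable_EFinP.
have mEh : measurable_fun setT (EFin \o h : R -> \bar R).
  exact/measurable_EFinP.
have gh0 (z : past X n * R) : (0 <= (g z.1 * h z.2)%:E)%E.
  by rewrite lee_fin mulr_ge0.
transitivity (\int[PJ]_z (g z.1 * h z.2)%:E)%E.
  by rewrite ge0_integral_distribution.
transitivity (\int[PI \x PX]_z (g z.1 * h z.2)%:E)%E.
  by apply: eq_measure_integral => A mA _; exact/esym/PJE.
rewrite fubini_tonelli1//.
transitivity (\int[PI]_w ((g w)%:E * \int[P]_w' (h (X n w'))%:E))%E.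
  apply: eq_integral => w _; rewrite /fubini_F/=.
  under eq_integral do rewrite EFinM.
  rewrite ge0_integralZl ?lee_fin//; last by move=> ? _; rewrite lee_fin.
  by rewrite [in LHS]ge0_integral_distribution.
rewrite (ge0_integralZr PI _ mEg)//; last 2 first.
- by move=> w _; rewrite lee_fin.
- by apply: integral_ge0 => w _; rewrite lee_fin.
by rewrite [in LHS]ge0_integral_distribution.
Qed.

End independence_integral.

(** * Real estimates and summability *)

Lemma is_derive1_mul (R : realType) (f g : R -> R) (x df dg : R) :
  is_derive x 1 f df -> is_derive x 1 g dg ->
  is_derive x 1 (fun y => f y * g y) (f x * dg + g x * df).
Proof. by move=> hf hg; apply: is_deriveM. Qed.

Lemma is_derive1_expRN (R : realType) (x : R) :
  is_derive x 1 (fun y => expR (- y)) (- expR (- x)).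
Proof.
have h : is_derive x 1 (expR \o -%R) (expR (- x) * - 1).
  by apply: is_derive1_comp; exact: is_deriveNid.
by apply: is_derive_eq h _; rewrite mulrN1.
Qed.

Lemma is_derive1_continuous (R : realType) (f df : R -> R) :
  (forall x : R, is_derive x 1 f (df x)) -> continuous f.
Proof.
by move=> hf x; apply: differentiable_continuous; exact/derivable1_diffP/ex_derive.
Qed.

Lemma is_derive1_horner (R : realType) (p : {poly R}) (x : R) :
  is_derive x 1 (fun y => p.[y]) (p^`()).[x].
Proof. exact: is_derive_poly. Qed.

(* [exp(-z) p(z)] has derivative [exp(-z) (p'(z) - p(z))], which for Taylor
   polynomials [p] of [exp] reduces to a single monomial or two. *)
Lemma expRN_horner_MVT (R : realType) (p : {poly R}) (a b : R) : a <= b ->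
  exists2 c, a <= c <= b & expR (- b) * p.[b] - expR (- a) * p.[a] =
    expR (- c) * ((p^`()).[c] - p.[c]) * (b - a).
Proof.
move=> ab.
pose df c := expR (- c) * ((p^`()).[c] - p.[c]).
have dphi (x : R) : is_derive x 1 (fun y => expR (- y) * p.[y]) (df x).
  apply: is_derive_eq (is_derive1_mul (is_derive1_expRN x)
    (is_derive1_horner p x)) _.
  by rewrite /df; ring.
have [c] := MVT_segment ab (fun x _ => dphi x)
  (continuous_subspaceT (is_derive1_continuous dphi)).
by rewrite in_itv/= => cab ->; exists c.
Qed.

(** With $p = 1 + x + x^2/2$ and $p_3 = p + x^3$, the function $e^{-x}p$ decreases, while
    $e^{-x}p_3$ increases for $x \le 1$; both equal 1 at 0. So the exponential lies between $p$ and
    $p_3$ on either side of 0. The coefficient 1 of the cube, instead of 1/6, makes $p_3' - p_3 =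
    5x^2/2 - x^3$ nonnegative there. *)
Lemma expR_taylor3 (R : realType) (x : R) : `|x| <= 1 ->
  `|expR x - (1 + x + x ^+ 2 / 2)| <= `|x| ^+ 3.
Proof.
move=> x1.
pose p : {poly R} := 1%:P + 'X + 2^-1 *: 'X^2.
pose p3 := p + 'X^3.
have pE y : p.[y] = 1 + y + y ^+ 2 / 2 by rewrite /p !(hornerD, hornerC, hornerX, hornerZ, hornerXn); field.
have p'E y : (p^`()).[y] = 1 + y.
  
  rewrite /p !derivD derivC derivX derivZ derivXn !(hornerD, hornerC, hornerX, hornerZ, hornerXn, hornerMn).
  by field.
have p3E y : p3.[y] = 1 + y + y ^+ 2 / 2 + y ^+ 3.
  by rewrite /p3 hornerD pE hornerXn.
have p3'E y : (p3^`()).[y] = 1 + y + 3 * y ^+ 2.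
  by rewrite /p3 derivD hornerD p'E derivXn hornerMn hornerXn; ring.
have e0 : expR (- x) * expR x = 1 by rewrite mulrC expRxMexpNx_1.
have ex0 := expR_gt0 (- x).
have lb y z : expR (- y) * z <= expR (- y) * expR y -> z <= expR y.
  by rewrite ler_pM2l// expR_gt0.
have ub y z : expR (- y) * expR y <= expR (- y) * z -> expR y <= z.
  by rewrite ler_pM2l// expR_gt0.
have [x0|x0] := leP 0 x.
  have x1' : x <= 1 by rewrite (le_trans _ x1)// ler_norm.
  rewrite [X in X ^+ 3]ger0_norm// ger0_norm ?subr_ge0.
    rewrite lerBlDl -p3E; apply: ub; rewrite e0.
    have [c /andP[c0 cx]] := expRN_horner_MVT p3 x0.
    rewrite [_ * p3.[0]]mulrC p3E oppr0 expR0 !p3E p3'E => H.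
    have c2 := sqr_ge0 c; have : c * c ^+ 2 <= 1 * c ^+ 2.
      by rewrite ler_wpM2r// (le_trans cx).
    have := expR_gt0 (- c).
    move: H; set A := expR _ * _; set B := expR (- c) => H B0 cc.
    have : 0 <= B * (1 + c + 3 * c ^+ 2 - (1 + c + c ^+ 2 / 2 + c ^+ 3)) * (x + 0).
      rewrite mulr_ge0 ?addr0// mulr_ge0 ?(ltW B0)//.
      by rewrite [c ^+ 3]exprS; lra.
    by rewrite -H; lra.
  rewrite -pE; apply: lb; rewrite e0.
  have [c /andP[c0 cx]] := expRN_horner_MVT p x0.
  rewrite [_ * p.[0]]mulrC oppr0 expR0 !pE p'E => H.
  have : expR (- c) * (1 + c - (1 + c + c ^+ 2 / 2)) * (x + 0) <= 0.
    rewrite mulr_le0_ge0 ?addr0// mulr_ge0_le0 ?expR_ge0//.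
    by have := sqr_ge0 c; lra.
  by rewrite -H; lra.
rewrite ler0_norm ?subr_le0; last first.
  rewrite -pE; apply: ub; rewrite e0.
  have [c /andP[c0 cx]] := expRN_horner_MVT p (ltW x0).
  rewrite [_ * p.[0]]mulrC oppr0 expR0 !pE p'E => H.
  have : expR (- c) * (1 + c - (1 + c + c ^+ 2 / 2)) * (0 - x) <= 0.
    rewrite mulr_le0_ge0 ?subr_ge0 ?(ltW x0)// mulr_ge0_le0 ?expR_ge0//.
    by have := sqr_ge0 c; lra.
  by rewrite -H; lra.
rewrite ltr0_norm// (_ : (- x) ^+ 3 = - x ^+ 3); last by ring.
suff : 1 + x + x ^+ 2 / 2 + x ^+ 3 <= expR x by lra.
rewrite -p3E; apply: lb; rewrite e0.
have [c /andP[c0 cx]] := expRN_horner_MVT p3 (ltW x0).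
rewrite [_ * p3.[0]]mulrC p3E oppr0 expR0 !p3E p3'E => H.
have : 0 <= expR (- c) * (1 + c + 3 * c ^+ 2 - (1 + c + c ^+ 2 / 2 + c ^+ 3)) * (0 - x).
  rewrite mulr_ge0 ?subr_ge0 ?(ltW x0)// mulr_ge0 ?expR_ge0//.
  rewrite [c ^+ 3]exprS; have c2 := sqr_ge0 c.
  have : c * c ^+ 2 <= 0 by rewrite mulr_le0_ge0.
  by lra.
by rewrite -H; lra.
Qed.

Lemma powR_expR (R : realType) (x y : R) : 0 < x -> x `^ y = expR (y * ln x).
Proof. by move=> x0; rewrite /powR gt_eqF. Qed.

(** A discrete comparison with the integral of $x^{-1-s}$: write $n + 1 = a(1 - 1/a)$ with $a = n +
    2$, then use $\ln(1 - 1/a) \le -1/a$ and $e^{s/a} \ge 1 + s/a$. *)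
Lemma powRN_le_telescope (R : realType) (s : R) (n : nat) : 0 < s ->
  n.+2%:R `^ (- (1 + s)) <= s^-1 * (n.+1%:R `^ (- s) - n.+2%:R `^ (- s)) :> R.
Proof.
move=> s0; set a : R := n.+2%:R.
have a0 : 0 < a by rewrite ltr0n.
have b0 : 0 < n.+1%:R :> R by rewrite ltr0n.
have bE : n.+1%:R = a * (1 - a^-1) :> R.
  by rewrite mulrBr mulr1 divff ?gt_eqF// /a -[n.+2]addn1 natrD addrK.
have c0 : 0 < 1 - a^-1 by move: b0; rewrite bE pmulr_rgt0.
have lnb : ln n.+1%:R <= ln a - a^-1.
  rewrite bE lnM ?posrE// lerD2l (le_trans (le_ln1Dx _))// ltrNl opprK.
  by rewrite -subr_gt0.
rewrite !powR_expR// ler_pdivlMl//.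
have -> : - (1 + s) * ln a = - s * ln a - ln a by ring.
rewrite expRB lnK ?posrE//.
set e := expR (- s * ln a).
rewrite lerBrDr.
apply: (@le_trans _ _ (e * expR (s / a))).
  have := expR_ge1Dx (s / a); rewrite -(ler_pM2l (expR_gt0 (- s * ln a))) -/e.
  by apply: le_trans; rewrite mulrDr mulr1 [e * (s / a)]mulrCA addrC.
rewrite -expRD ler_expR.
have : s * ln n.+1%:R <= s * (ln a - a^-1) by rewrite ler_pM2l.
by rewrite mulrBr !mulNr lerNr opprD opprK.
Qed.

Lemma nneseries_powRN_lty (R : realType) (s : R) : 0 < s ->
  (\sum_(0 <= k <oo) (k.+1%:R `^ (- (1 + s)) : R)%:E < +oo)%E.
Proof.
move=> s0; apply: (@le_lt_trans _ _ (1 + s^-1)%:E); last exact: ltry.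
apply: lime_le.
  by apply: is_cvg_nneseries => n _ _; rewrite lee_fin powR_ge0.
apply: nearW => n; rewrite sumEFin lee_fin.
case: n => [|n]; first by rewrite big_nil addr_ge0// invr_ge0 ltW.
suff : \sum_(0 <= k < n.+1) k.+1%:R `^ (- (1 + s)) <=
    1 + s^-1 * (1 - n.+1%:R `^ (- s)).
  move=> /le_trans; apply; rewrite lerD2l ler_piMr ?invr_ge0 ?(ltW s0)// gerBl powR_ge0.
elim: n => [|n ih]; first by rewrite big_nat1 powR1 subrr mulr0 addr0.
rewrite big_nat_recr//=.
have := powRN_le_telescope n s0.
move: ih; set A := \sum_(_ <= _ < _) _; set B := _ `^ _; set C := _ `^ _.
set D := _ `^ _; lra.
Qed.

(** From $\ln u < u \le \epsilon u^2/2 \le \epsilon e^u$. It keeps tilts of the form $\sqrt{\ln u /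
    e^u}$ in the range where the moment bounds hold. *)
Lemma ln_le_eps_expR (R : realType) (eps u : R) : 0 < eps -> 2 / eps <= u ->
  ln u <= eps * expR u.
Proof.
move=> e0 eu.
have u0 : 0 < u by rewrite (lt_le_trans _ eu)// divr_gt0.
apply: (le_trans (ltW (ln_sublinear u0))).
have e2 : eps * (1 + u ^+ 2 / 2) <= eps * expR u.
  by rewrite ler_pM2l// (le_trans _ (expR_ge1Dxn 1 (ltW u0))).
apply: le_trans e2.
have : 2 * u <= u * eps * u by rewrite ler_pM2r// -ler_pdivrMr.
by rewrite expr2; lra.
Qed.

Lemma near_le_ln_natM (R : realType) (M c : R) : 0 < c ->
  \forall k \near \oo, M <= ln (k.+1%:R * c).
Proof.
move=> c0; near=> k.
rewrite -[leLHS]expRK ler_ln ?posrE ?expR_gt0 ?mulr_gt0// -ler_pdivrMr//.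
apply: (@le_trans _ _ k%:R); last by rewrite ler_nat.
by near: k; exact: nbhs_infty_ger.
Unshelve. all: by end_near. Qed.

Lemma near_le_natSM (R : realType) (M c : R) : 0 < c ->
  \forall k \near \oo, M <= k.+1%:R * c.
Proof.
move=> c0; near=> k; rewrite -ler_pdivrMr//.
apply: (@le_trans _ _ k%:R); last by rewrite ler_nat.
by near: k; exact: nbhs_infty_ger.
Unshelve. all: by end_near. Qed.

Lemma borel_cantelli_powR (R : realType) d (T : measurableType d)
    (mu : {measure set T -> \bar R}) (F : (set T)^nat) (C s : R) :
  0 <= C -> 0 < s -> (forall k, measurable (F k)) ->
  (\forall k \near \oo, (mu (F k) <= (C * k.+1%:R `^ (- (1 + s)))%:E)%E) ->
  {ae mu, forall w, \forall k \near \oo, ~ F k w}.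
Proof.
move=> C0 s0 mF [N _ FN].
(* The finitely many events without a bound are replaced by the empty set, so that the whole series
   is controlled. *)
pose G k := if (k < N)%N then set0 else F k.
have mG k : measurable (G k) by rewrite /G; case: ifP.
have G0 : mu (lim_sup_set G) = 0%E.
  apply: lim_sup_set_cvg0 => //.
  apply: (@le_lt_trans _ _
      (C%:E * \sum_(0 <= k <oo) (k.+1%:R `^ (- (1 + s)) : R)%:E)%E).
    rewrite -nneseriesZl; last by move=> *; rewrite lee_fin powR_ge0.
    apply: lee_nneseries => // k _; rewrite -EFinM /G; case: ltnP => kN.
      by rewrite measure0 lee_fin mulr_ge0// powR_ge0.
    exact: FN.
  by rewrite lte_mul_pinfty// ?nneseries_powRN_lty// nneseries_ge0// => *;
    rewrite lee_fin powR_ge0.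
exists (lim_sup_set G); split => //.
  apply: bigcapT_measurable => n.
  exact: bigcup_measurable.
move=> w /= nw n _ /=; apply: contrapT => nG; apply: nw.
exists (maxn n N) => // k /=; rewrite geq_max => /andP[nk Nk] Fk.
by apply: nG; exists k => //; rewrite /G ltnNge Nk.
Qed.

(** * Exponential bounds and the law of the iterated logarithm *)

Section moment_generating_bounds.
Context (R : realType) (d : measure_display) (T : measurableType d)
  (P : probability T R).

Lemma bounded_integrable (f : T -> R) (K : R) :
  measurable_fun setT f -> (forall w, `|f w| <= K) ->
  P.-integrable setT (EFin \o f).
Proof.
move=> mf fK; apply: measurable_bounded_integrable => //.
  by rewrite (le_lt_trans (probability_le1 _ _))// ltry.
by exists K; split => [|M KM w _ /=]; [exact: num_real|rewrite (le_trans (fK w))// ltW].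
Qed.

Lemma bounded_Rintegral_cst (r : R) : \int[P]_w r = r.
Proof.
by rewrite Rintegral_cst// [X in fine X](probability_setT P) mulr1.
Qed.

Lemma bounded_expRM (f : T -> R) (K t : R) : (forall w, `|f w| <= K) ->
  forall w, `|expR (t * f w)| <= expR (`|t| * K).
Proof.
move=> fK w; rewrite ger0_norm ?expR_ge0// ler_expR.
by rewrite (le_trans (ler_norm _))// normrM ler_wpM2l.
Qed.

Lemma measurable_expRM (f : T -> R) (t : R) : measurable_fun setT f ->
  measurable_fun setT (fun w => expR (t * f w)).
Proof. by move=> mf; apply: measurableT_comp => //; exact: measurable_funM. Qed.

Lemma integrable_EFinD (f g : T -> R) :
  P.-integrable setT (EFin \o f) -> P.-integrable setT (EFin \o g) ->
  P.-integrable setT (EFin \o (fun w => f w + g w)).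
Proof. by move=> hf hg; exact: (integrableD measurableT hf hg). Qed.

Lemma Rintegral_quadratic (f : T -> R) (K c0 c1 c2 : R) :
  measurable_fun setT f -> (forall w, `|f w| <= K) ->
  P.-integrable setT (EFin \o (fun w => c0 + c1 * f w + c2 * f w ^+ 2)) /\
  \int[P]_w (c0 + c1 * f w + c2 * f w ^+ 2) =
    c0 + c1 * \int[P]_w f w + c2 * \int[P]_w (f w ^+ 2).
Proof.
move=> mf fK.
have mf2 : measurable_fun setT (fun w => f w ^+ 2) by exact: measurable_funX.
have fK2 w : `|f w ^+ 2| <= K ^+ 2.
  by rewrite normrX lerXn2r ?nnegrE// (le_trans _ (fK w)).
have i1 := bounded_integrable mf fK.
have i2 := bounded_integrable mf2 fK2.
have ic : P.-integrable setT (EFin \o (fun=> c0)).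
  by apply: (@bounded_integrable _ `|c0|) => //; exact: measurable_cst.
have j1 : P.-integrable setT (EFin \o (fun w => c1 * f w)).
  apply: (@bounded_integrable _ (`|c1| * K)); first exact: measurable_funM.
  by move=> w; rewrite normrM ler_wpM2l.
have j2 : P.-integrable setT (EFin \o (fun w => c2 * f w ^+ 2)).
  apply: (@bounded_integrable _ (`|c2| * K ^+ 2)); first exact: measurable_funM.
  by move=> w; rewrite normrM ler_wpM2l.
have j01 : P.-integrable setT (EFin \o (fun w => c0 + c1 * f w)).
  exact: integrable_EFinD.
split.
  exact: integrable_EFinD.
by rewrite RintegralD// RintegralD// !RintegralZl// bounded_Rintegral_cst.
Qed.

Lemma expRM_taylor3 (x t K : R) : 0 <= t -> t * K <= 1 -> `|x| <= K ->
  `|expR (t * x) - (1 + t * x + t ^+ 2 / 2 * x ^+ 2)| <= t ^+ 3 * K ^+ 3.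
Proof.
move=> t0 tK xK.
have txK : `|t * x| <= t * K by rewrite normrM ger0_norm// ler_wpM2l.
have -> : t ^+ 2 / 2 * x ^+ 2 = (t * x) ^+ 2 / 2 by ring.
rewrite (le_trans (expR_taylor3 (le_trans txK tK)))// -exprMn.
by rewrite lerXn2r ?nnegrE// (le_trans _ txK).
Qed.

(** The first term of [t0] makes the Taylor estimate available; the second lets the gap [b - v]
    absorb the cubic remainder. As [t0] does not depend on [f], it serves all observations at
    once. *)
Lemma mgf_le (K v b : R) : 0 < K -> v < b ->
  exists2 t0, 0 < t0 & forall f : T -> R,
    measurable_fun setT f -> (forall w, `|f w| <= K) ->
    \int[P]_w f w = 0 -> \int[P]_w (f w ^+ 2) <= v ->
    forall t, 0 <= t <= t0 -> \int[P]_w expR (t * f w) <= expR (b * t ^+ 2 / 2).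
Proof.
move=> K0 vb; have K30 : 0 < K ^+ 3 by rewrite exprn_gt0.
exists (Num.min K^-1 ((b - v) / (2 * K ^+ 3))).
  by rewrite lt_min invr_gt0 K0 divr_gt0 ?subr_gt0 ?mulr_gt0.
move=> f mf fK f0 fv t /andP[t0]; rewrite le_min => /andP[tK].
rewrite ler_pdivlMr ?mulr_gt0// => tv.
have tK1 : t * K <= 1 by rewrite -ler_pdivlMr// mul1r.
have [iq Eq] := Rintegral_quadratic (1 + t ^+ 3 * K ^+ 3) t (t ^+ 2 / 2) mf fK.
apply: (@le_trans _ _ (\int[P]_w (1 + t ^+ 3 * K ^+ 3 + t * f w + t ^+ 2 / 2 * f w ^+ 2))).
  apply: le_Rintegral => //.
    exact: (bounded_integrable (measurable_expRM t mf) (bounded_expRM t fK)).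
  move=> w _; have := expRM_taylor3 t0 tK1 (fK w).
  by rewrite ler_norml => /andP[_]; lra.
rewrite Eq f0 mulr0 addr0; apply: le_trans (expR_ge1Dx _).
rewrite -addrA lerD2l.
have t20 := sqr_ge0 t.
have h1 : t ^+ 2 / 2 * \int[P]_w (f w ^+ 2) <= t ^+ 2 / 2 * v.
  by rewrite ler_wpM2l// divr_ge0.
have h2 : t ^+ 2 * (t * (2 * K ^+ 3)) <= t ^+ 2 * (b - v) by rewrite ler_wpM2l.
by rewrite [t ^+ 3]exprSr; lra.
Qed.

(** The gap [v - a] pays twice: for the cubic remainder, as $2K^3$, and for the terms of order at
    least two of $\exp(at^2/2)$, as $a^2$. The bounds $1$ and $1/(1+a)$ on [t] keep that exponent at
    most 1, so the same Taylor estimate applies to it. *)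
Lemma mgf_ge (K v a : R) : 0 < K -> 0 <= a -> a < v ->
  exists2 t0, 0 < t0 & forall f : T -> R,
    measurable_fun setT f -> (forall w, `|f w| <= K) ->
    \int[P]_w f w = 0 -> v <= \int[P]_w (f w ^+ 2) ->
    forall t, 0 <= t <= t0 -> expR (a * t ^+ 2 / 2) <= \int[P]_w expR (t * f w).
Proof.
move=> K0 a0 av; have K30 : 0 < K ^+ 3 by rewrite exprn_gt0.
have D0 : 0 < 2 * K ^+ 3 + a ^+ 2 by rewrite ltr_wpDr ?sqr_ge0 ?mulr_gt0.
exists (Num.min (Num.min K^-1 1) (Num.min (1 + a)^-1 ((v - a) / (2 * K ^+ 3 + a ^+ 2)))).
  by rewrite !lt_min invr_gt0 K0 ltr01 invr_gt0 ltr_pwDl//= divr_gt0 ?subr_gt0.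
move=> f mf fK f0 fv t /andP[t0]; rewrite !le_min -!andbA => /and4P[tK t1 ta].
rewrite ler_pdivlMr// => tv.
have tK1 : t * K <= 1 by rewrite -ler_pdivlMr// mul1r.
have ta1 : t * (1 + a) <= 1 by rewrite -ler_pdivlMr ?ltr_pwDl// mul1r.
have [iq Eq] := Rintegral_quadratic (1 - t ^+ 3 * K ^+ 3) t (t ^+ 2 / 2) mf fK.
apply: (@le_trans _ _ (\int[P]_w (1 - t ^+ 3 * K ^+ 3 + t * f w + t ^+ 2 / 2 * f w ^+ 2))); last first.
  apply: le_Rintegral => //.
    exact: (bounded_integrable (measurable_expRM t mf) (bounded_expRM t fK)).
  move=> w _; have := expRM_taylor3 t0 tK1 (fK w).
  by rewrite ler_norml => /andP[+ _]; lra.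
rewrite Eq f0 mulr0 addr0.
have t20 := sqr_ge0 t.
have h1 : t ^+ 2 / 2 * v <= t ^+ 2 / 2 * \int[P]_w (f w ^+ 2).
  by rewrite ler_wpM2l// divr_ge0.
have h2 : t ^+ 2 * (t * (2 * K ^+ 3 + a ^+ 2)) <= t ^+ 2 * (v - a) by rewrite ler_wpM2l.
pose y := a * t ^+ 2 / 2.
have y0 : 0 <= y by rewrite /y !mulr_ge0.
have at1 : a * t <= 1 by lra.
have y1 : y <= 1.
  have : a * t * t <= 1 * 1 by rewrite ler_pM// mulr_ge0.
  by rewrite /y expr2; lra.
have := expR_taylor3 (x := y); rewrite ger0_norm// => /(_ y1).
rewrite ler_norml => /andP[_ ey]; rewrite -/y.
have y3 : y ^+ 3 <= y ^+ 2.
  by rewrite [y ^+ 3]exprSr ler_piMr// sqr_ge0.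
have yE : y ^+ 2 = t ^+ 2 * (a ^+ 2 * t ^+ 2) / 4 by rewrite /y; field.
have tt : a ^+ 2 * t ^+ 2 <= a ^+ 2 * t.
  by rewrite ler_wpM2l ?sqr_ge0// expr2 ler_piMr.
have ttt : t ^+ 2 * (a ^+ 2 * t ^+ 2) <= t ^+ 2 * (a ^+ 2 * t) by rewrite ler_wpM2l.
have ya : y = t ^+ 2 * a / 2 by rewrite /y; ring.
have at0 : 0 <= t ^+ 2 * (a ^+ 2 * t) by rewrite !mulr_ge0// sqr_ge0.
by rewrite [t ^+ 3]exprSr; lra.
Qed.

End moment_generating_bounds.

(** * Partial sums of bounded terms and the walk stopped at first passage *)

Section bounded_walk.
Context (R : realType) (d : measure_display) (Omega : measurableType d)
  (P : probability Omega R) (X : nat -> {RV P >-> R}).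
Hypothesis indepX : mutually_independent P (fun i => (X i : Omega -> R)).

Lemma past_indep_Rintegral n (g : Omega -> R) (h : R -> R) (Kg Kh : R) :
  measurable_fun setT (g : past X n -> R) -> measurable_fun setT h ->
  (forall w, 0 <= g w <= Kg) -> (forall x, 0 <= h x <= Kh) ->
  \int[P]_w (g w * h (X n w)) = \int[P]_w g w * \int[P]_w h (X n w).
Proof.
move=> mg mh gK hK.
have g0 w : 0 <= g w by have /andP[] := gK w.
have h0 w : 0 <= h w by have /andP[] := hK w.
have mhX : measurable_fun setT (fun w => h (X n w)) by exact: measurableT_comp.
rewrite /Rintegral (past_indep_integral indepX)// fineM//.
  apply: integrable_fin_num => //; apply: (@bounded_integrable _ _ _ _ _ Kg).
    exact: past_measurable_fun mg.
  by move=> w; rewrite ger0_norm//; have /andP[] := gK w.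
apply: integrable_fin_num => //; apply: (@bounded_integrable _ _ _ _ _ Kh) => //.
by move=> w; rewrite ger0_norm//; have /andP[] := hK (X n w).
Qed.

Lemma fine_probability (A : set Omega) : measurable A ->
  P A = (\int[P]_w \1_A w)%:E.
Proof.
move=> mA; rewrite /Rintegral integral_indic// setIT fineK//.
exact: fin_num_measure.
Qed.

Context (psi : R -> R) (K : R).
Hypotheses (mpsi : measurable_fun setT psi) (psiK : forall x, `|psi x| <= K).

Let K_ge0 : 0 <= K. Proof. exact: le_trans (psiK 0). Qed.

Definition walk (a l : nat) (w : Omega) : R := \sum_(i < l) psi (X (a + i) w).

Lemma walkS a l w : walk a l.+1 w = walk a l w + psi (X (a + l) w).
Proof. by rewrite /walk big_ord_recr. Qed.

Lemma walk0 a w : walk a 0 w = 0.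
Proof. by rewrite /walk big_ord0. Qed.

Lemma walk_cat m l w : walk 0 (m + l) w = walk 0 m w + walk m l w.
Proof.
elim: l => [|l ih]; first by rewrite walk0 addn0 addr0.
by rewrite addnS !walkS add0n ih addrA.
Qed.

Lemma measurable_past_psi n i : (i < n)%N ->
  measurable_fun setT (fun w : past X n => psi (X i w)).
Proof. by move=> ltin; apply: measurableT_comp => //; exact: measurable_past. Qed.

Lemma measurable_past_walk a l :
  measurable_fun setT (walk a l : past X (a + l) -> R).
Proof.
apply: measurable_sum => i; apply: measurable_past_psi.
by rewrite ltn_add2l.
Qed.

Lemma measurable_walk a l : measurable_fun setT (walk a l).
Proof. exact: past_measurable_fun (@measurable_past_walk a l). Qed.

Lemma normr_walk a l w : `|walk a l w| <= l%:R * K.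
Proof.
rewrite (le_trans (ler_norm_sum _ _ _))// (le_trans (ler_sum _ (fun i _ => psiK _)))//.
by rewrite sumr_const card_ord mulr_natl.
Qed.

Lemma measurable_expR_psi t : measurable_fun setT (fun x => expR (t * psi x)).
Proof. exact: measurable_expRM. Qed.

Lemma expR_psi_bound t x : 0 <= expR (t * psi x) <= expR (`|t| * K).
Proof.
rewrite expR_ge0 ler_expR (le_trans (ler_norm _))// normrM.
by rewrite ler_wpM2l.
Qed.

Lemma Rintegral_expR_walkS (g : Omega -> R) (Kg : R) a l t :
  measurable_fun setT (g : past X a -> R) -> (forall w, 0 <= g w <= Kg) ->
  \int[P]_w (g w * expR (t * walk a l.+1 w)) =
  \int[P]_w (g w * expR (t * walk a l w)) * \int[P]_w expR (t * psi (X (a + l) w)).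
Proof.
move=> mg gK.
rewrite -(@past_indep_Rintegral _ (fun w => g w * expR (t * walk a l w))
  (fun x => expR (t * psi x)) (Kg * expR (`|t| * (l%:R * K))) (expR (`|t| * K))).
- apply: eq_Rintegral => w _; rewrite walkS mulrDr expRD mulrA.
  by [].
- apply: measurable_funM; first exact: measurable_fun_past_leq (leq_addr _ _) mg.
  by apply: measurable_expRM; exact: measurable_past_walk.
- exact: measurable_expR_psi.
- move=> w; have /andP[g0 gw] := gK w; rewrite mulr_ge0 ?expR_ge0//=.
  rewrite ler_pM ?expR_ge0// ler_expR (le_trans (ler_norm _))// normrM.
  by rewrite ler_wpM2l// normr_walk.
- by move=> x; exact: expR_psi_bound.
Qed.

Fixpoint stopped_walk (x : R) (n : nat) (w : Omega) : R :=
  if n is n'.+1 then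
    let z := stopped_walk x n' w in if x <= z then z else z + psi (X n' w)
  else 0.

(** If the stopped value is below [x], so is every partial sum up to time [n]: this is how a bound
    on one variable controls a whole block. *)
Lemma stopped_walkP x n w : 0 < x ->
  x <= stopped_walk x n w \/
  (stopped_walk x n w = walk 0 n w /\ forall j, (j <= n)%N -> walk 0 j w < x).
Proof.
move=> x0; elim: n => [|n ih] /=.
  by right; split => [|j]; rewrite ?walk0// leqn0 => /eqP ->; rewrite walk0.
case: ih => [xz|[zE xn]]; first by left; rewrite xz.
have -> : (x <= stopped_walk x n w) = false by rewrite zE leNgt xn.
rewrite zE.
have [xS|Sx] := leP x (walk 0 n w + psi (X n w)); [by left|right].
rewrite walkS add0n; split => // j; rewrite leq_eqVlt => /predU1P[->|]; last exact: xn.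
by rewrite walkS add0n.
Qed.

Lemma measurable_past_stopped_walk x n :
  measurable_fun setT (stopped_walk x n : past X n -> R).
Proof.
elim: n => [|n ih] /=; first exact: measurable_cst.
have ih' := measurable_fun_past_leq (leqnSn n) ih.
apply: measurable_fun_ifT => //; first by apply: measurable_fun_ler.
by apply: measurable_funD => //; exact: measurable_past_psi.
Qed.

Lemma measurable_stopped_walk x n : measurable_fun setT (stopped_walk x n).
Proof. exact: past_measurable_fun (@measurable_past_stopped_walk x n). Qed.

Lemma normr_stopped_walk x n w : `|stopped_walk x n w| <= n%:R * K.
Proof.
elim: n => [|n ih] /=; first by rewrite normr0 mul0r.
rewrite -natr1 mulrDl mul1r; case: ifP => _.
  by rewrite (le_trans ih)// lerDl.
by rewrite (le_trans (ler_normD _ _))// lerD.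
Qed.

(* Stopping the walk at the first passage above [x] replaces the maximum over
   [j <= n] by a single variable, whose moment generating function obeys the
   same recursion as that of the walk. *)
Lemma Rintegral_expR_stopped_walk x n t b : 0 <= b ->
  (forall i, (i < n)%N -> \int[P]_w expR (t * psi (X i w)) <= expR b) ->
  \int[P]_w expR (t * stopped_walk x n w) <= expR (n%:R * b).
Proof.
move=> b0; elim: n => [|n ih] Hn /=.
  under eq_Rintegral do rewrite mulr0 expR0.
  by rewrite bounded_Rintegral_cst mul0r expR0.
pose Z := stopped_walk x n.
have mZ := @measurable_past_stopped_walk x n.
pose h1 w := if x <= Z w then expR (t * Z w) else 0.
pose h2 w := if x <= Z w then 0 else expR (t * Z w).
pose KZ := expR (`|t| * (n%:R * K)).
have ZK w : expR (t * Z w) <= KZ.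
  rewrite ler_expR (le_trans (ler_norm _))// normrM ler_wpM2l//.
  exact: normr_stopped_walk.
have h1K w : 0 <= h1 w <= KZ.
  by rewrite /h1; case: ifP => _; rewrite ?lexx ?expR_ge0//= ZK.
have h2K w : 0 <= h2 w <= KZ.
  by rewrite /h2; case: ifP => _; rewrite ?lexx ?expR_ge0//= ZK.
have meZ : measurable_fun setT (fun w : past X n => expR (t * Z w)).
  exact: measurable_expRM.
have mxZ : measurable_fun setT (fun w : past X n => x <= Z w).
  exact: measurable_fun_ler.
have mh1 : measurable_fun setT (h1 : past X n -> R) by exact: measurable_fun_ifT.
have mh2 : measurable_fun setT (h2 : past X n -> R) by exact: measurable_fun_ifT.
have bint (h : Omega -> R) C : measurable_fun setT (h : past X n -> R) ->
    (forall w, 0 <= h w <= C) -> P.-integrable setT (EFin \o h).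
  move=> mh hC; apply: (@bounded_integrable _ _ _ _ _ C).
    exact: past_measurable_fun mh.
  by move=> w; have /andP[h0 hw] := hC w; rewrite ger0_norm.
have ih1 := bint _ _ mh1 h1K.
have ih2 := bint _ _ mh2 h2K.
pose M := \int[P]_w expR (t * psi (X n w)).
have -> : \int[P]_w expR (t * (if x <= Z w then Z w else Z w + psi (X n w))) =
    \int[P]_w (h1 w + h2 w * expR (t * psi (X n w))).
  apply: eq_Rintegral => w _; rewrite /h1 /h2; case: ifP => _.
    by rewrite mul0r addr0.
  by rewrite add0r mulrDr expRD.
rewrite RintegralD//; last first.
  apply: (@bounded_integrable _ _ _ _ _ (KZ * expR (`|t| * K))).
    apply: measurable_funM; first exact: past_measurable_fun mh2.
    by apply: (measurableT_comp (measurable_expR_psi t)).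
  move=> w; have /andP[h20 h2w] := h2K w.
  have /andP[e0 ew] := expR_psi_bound t (X n w).
  by rewrite ger0_norm ?mulr_ge0// ler_pM.
rewrite (past_indep_Rintegral mh2 (measurable_expR_psi t) h2K (expR_psi_bound t)).
have I1 : 0 <= \int[P]_w h1 w.
  by apply: Rintegral_ge0 => w _; have /andP[] := h1K w.
have I2 : 0 <= \int[P]_w h2 w.
  by apply: Rintegral_ge0 => w _; have /andP[] := h2K w.
apply: (@le_trans _ _ ((\int[P]_w h1 w + \int[P]_w h2 w) * expR b)).
  rewrite mulrDl lerD ?ler_wpM2l// ?Hn//.
  by rewrite ler_peMr// -expR0 ler_expR.
rewrite -RintegralD// -natr1 mulrDl mul1r expRD ler_wpM2r ?expR_ge0//.
rewrite (_ : \int[P]_w (h1 w + h2 w) = \int[P]_w expR (t * Z w)).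
  by apply: ih => i ltin; apply: Hn; rewrite (ltn_trans ltin).
by apply: eq_Rintegral => w _; rewrite /h1 /h2; case: ifP; rewrite ?addr0 ?add0r.
Qed.

Lemma markov_expR (f : Omega -> R) (C t x : R) : 0 <= t ->
  measurable_fun setT f -> (forall w, `|f w| <= C) ->
  (P [set w | x <= f w]%R <= (expR (- (t * x)) * \int[P]_w expR (t * f w))%:E)%E.
Proof.
move=> t0 mf fC.
have mA : measurable [set w | x <= f w].
  by rewrite -[X in measurable X]setTI; exact: (measurable_fun_ler (measurable_cst _) mf).
rewrite fine_probability// lee_fin expRN ler_pdivlMl ?expR_gt0//.
rewrite -RintegralZl//; last first.
  apply: (@bounded_integrable _ _ _ _ _ 1); first exact: measurable_indic.
  by move=> w; rewrite indicE; case: (_ \in _); rewrite ?normr1 ?normr0.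
apply: le_Rintegral => //.
- apply: (@bounded_integrable _ _ _ _ _ (expR (t * x))).
    by apply: measurable_funM => //; exact: measurable_indic.
  move=> w; rewrite indicE normrM ger0_norm ?expR_ge0// ler_piMr ?expR_ge0//.
  by case: (_ \in _); rewrite ?normr1 ?normr0.
- exact: (bounded_integrable P (measurable_expRM t mf) (bounded_expRM t fC)).
move=> w _; rewrite indicE; case: (boolP (w \in _)) => [|_]; last first.
  by rewrite mulr0 expR_ge0.
by rewrite inE/= => xf; rewrite mulr1 ler_expR ler_wpM2l.
Qed.

End bounded_walk.

(** * Upper half of the law of the iterated logarithm *)

Section upper_lil.
Context (R : realType) (d : measure_display) (Omega : measurableType d)
  (P : probability Omega R) (X : nat -> {RV P >-> R}).
Hypothesis indepX : mutually_independent P (fun i => (X i : Omega -> R)).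
Context (psi : R -> R) (K v : R).
Hypotheses (mpsi : measurable_fun setT psi) (psiK : forall x, `|psi x| <= K).
Hypotheses (K_gt0 : 0 < K) (psi_mean : forall i, \int[P]_w psi (X i w) = 0).
Hypothesis psi_var : forall i, \int[P]_w (psi (X i w) ^+ 2) <= v.

Lemma lil_level_le (c u n : R) : 0 <= c -> 1 <= u -> expR u <= n ->
  c * Num.sqrt (expR u * ln u) <= c * Num.sqrt (n * ln (ln n)).
Proof.
move=> c0 u1 un.
have n0 : 0 < n := lt_le_trans (expR_gt0 u) un.
have u_ln : u <= ln n by rewrite -[leLHS]expRK ler_ln ?posrE ?expR_gt0.
have u0 : 0 < u by rewrite (lt_le_trans _ u1).
have ln0 : 0 < ln n by rewrite (lt_le_trans u0).
rewrite ler_wpM2l// ler_sqrt.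
  by rewrite ler_pM ?expR_ge0 ?ln_ge0// ler_ln.
by rewrite mulr_ge0 ?ln_ge0 ?(ltW n0)// (le_trans u1).
Qed.

(** Blocks run between consecutive powers of [q]. At level $c\sqrt{e^u \ln u}$, where $e^u$ is the
    left end, and with tilt $\tau\sqrt{\ln u/e^u}$, the Chernoff exponent is $(-\tau c +
    qb\tau^2/2)\ln u$. The best choice $\tau = c/(bq)$ gives $-\beta\ln u$ with $\beta = c^2/(2bq)$;
    as $u$ is linear in the block index, $\beta > 1$ yields summability. *)
Lemma upper_lil (c : R) : 0 < c -> 2 * v < c ^+ 2 ->
  {ae P, forall w, \forall n \near \oo,
    walk X psi 0 n w <= c * Num.sqrt (n%:R * ln (ln n%:R))}.
Proof.
move=> c0 vc.
have v0 : 0 <= v.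
  apply: le_trans (psi_var 0%N); apply: Rintegral_ge0 => w _; exact: sqr_ge0.
(* [b] lies strictly between [v] and $c^2/2$, and [q] strictly between 1 and $c^2/(2b)$, which
   leaves [beta] above 1. *)
pose b := (v + c ^+ 2 / 2) / 2.
have vb : v < b by rewrite /b; lra.
have bc : 2 * b < c ^+ 2 by rewrite /b; lra.
have b0 : 0 < b by lra.
clearbody b.
pose q := (1 + c ^+ 2 / (2 * b)) / 2.
have q1' : 1 < c ^+ 2 / (2 * b) by rewrite ltr_pdivlMr ?mulr_gt0// mul1r.
have q1 : 1 < q by rewrite /q; lra.
have qc : q < c ^+ 2 / (2 * b) by rewrite /q; lra.
have q0 : 0 < q by lra.
clearbody q.
pose L := ln q; have L0 : 0 < L by rewrite ln_gt0.
pose beta := c ^+ 2 / (2 * b * q).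
have beta1 : 1 < beta.
  by move: qc; rewrite /beta ltr_pdivlMr ?mulr_gt0// ltr_pdivlMr ?mulr_gt0// mul1r mulrC.
have [t0 t0_gt0 mgf] := mgf_le P K_gt0 vb.
have [tau tau0 tauE] : exists2 tau, 0 < tau & tau = c / (b * q).
  by exists (c / (b * q)); rewrite // divr_gt0// mulr_gt0.
pose u k : R := k.+1%:R * L.
have u_gt0 k : 0 < u k by rewrite mulr_gt0.
have uS k : expR (u k.+1) = q * expR (u k).
  by rewrite /u -[k.+2%:R]natr1 mulrDl mul1r expRD lnK ?posrE// mulrC.
pose n k := Num.truncn (expR (u k.+1)).
pose x k := c * Num.sqrt (expR (u k) * ln (u k)).
pose F k := [set w | x k <= stopped_walk X psi (x k) (n k) w].
have mF k : measurable (F k).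
  rewrite -[F k]setTI; apply: measurable_fun_ler => //.
  exact: measurable_stopped_walk.
have F_bc : {ae P, forall w, \forall k \near \oo, ~ F k w}.
  apply: (@borel_cantelli_powR _ _ _ P F (L `^ (- beta)) (beta - 1)) => //.
  - exact: powR_ge0.
  - by rewrite subr_gt0.
  have e0 : 0 < (t0 / tau) ^+ 2 by rewrite exprn_gt0// divr_gt0.
  near=> k.
  have u1 : 1 <= u k by near: k; exact: near_le_natSM.
  have l0 : 0 <= ln (u k) by rewrite ln_ge0.
  have lE : ln (u k) <= (t0 / tau) ^+ 2 * expR (u k).
    by apply: ln_le_eps_expR => //; near: k; exact: near_le_natSM.
  pose t := tau * Num.sqrt (ln (u k) / expR (u k)).
  have t_ge0 : 0 <= t by rewrite mulr_ge0 ?sqrtr_ge0// ltW.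
  have t_le : t <= t0.
    rewrite /t mulrC -ler_pdivlMr// -[leRHS]ger0_norm ?divr_ge0 ?(ltW t0_gt0) ?(ltW tau0)//.
    rewrite -sqrtr_sqr ler_sqrt; last exact: ltW.
    by rewrite ler_pdivrMr ?expR_gt0.
  have tt : t ^+ 2 = tau ^+ 2 * (ln (u k) / expR (u k)).
    by rewrite /t exprMn sqr_sqrtr// divr_ge0// expR_ge0.
  have tx : t * x k = tau * c * ln (u k).
    rewrite /t /x mulrACA -sqrtrM ?divr_ge0 ?expR_ge0//.
    rewrite (_ : ln (u k) / expR (u k) * _ = ln (u k) ^+ 2); last first.
      by field; rewrite gt_eqF// expR_gt0.
    by rewrite sqrtr_sqr ger0_norm.
  have := (markov_expR P (x k) t_ge0
    (@measurable_stopped_walk _ _ _ _ X psi mpsi (x k) (n k))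
    (normr_stopped_walk X psiK (x k) (n k))).
  move=> /le_trans; apply.
  rewrite lee_fin.
  have bt0 : 0 <= b * t ^+ 2 / 2 by rewrite divr_ge0// mulr_ge0 ?sqr_ge0// ltW.
  apply: (@le_trans _ _ (expR (- (t * x k)) * expR ((n k)%:R * (b * t ^+ 2 / 2)))).
    rewrite ler_wpM2l ?expR_ge0//.
    apply: (Rintegral_expR_stopped_walk indepX mpsi psiK) => // i _.
    apply: (mgf (psi \o X i)) => //=; last by rewrite t_ge0.
    exact: measurableT_comp.
  rewrite -expRD [leRHS](_ : _ = expR (- beta * ln (u k))); last first.
    rewrite (_ : 1 + (beta - 1) = beta); last by ring.
    by rewrite -powRM ?(ltW L0)// powR_expR ?mulr_gt0// [L * _]mulrC.
  rewrite ler_expR tx.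
  have nE : (n k)%:R <= q * expR (u k) by rewrite -uS truncn_le expR_ge0.
  apply: (@le_trans _ _ (- (tau * c * ln (u k)) + q * expR (u k) * (b * t ^+ 2 / 2))).
    by rewrite lerD2l ler_wpM2r.
  rewrite tt le_eqVlt; apply/orP; left; apply/eqP; rewrite tauE /beta.
  by field; rewrite !gt_eqF// expR_gt0.
apply: filterS F_bc => w [k0 _ Fk0].
near=> N.
have N0 : (0 < N)%N by near: N; exact: nbhs_infty_gt.
have N0R : 0 < N%:R :> R by rewrite ltr0n.
have ln_ge (M : R) : expR M <= N%:R -> M <= ln N%:R.
  by move=> MN; rewrite -[leLHS]expRK ler_ln ?posrE ?expR_gt0.
(* The constant secures two facts about the block containing [N]: its index is at least [k0], and
   [u k] exceeds 1, so that the level is positive. *)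
have lnN : (k0%:R + 1 + 2 * L^-1) * L <= ln N%:R.
  by apply: ln_ge; near: N; exact: nbhs_infty_ger.
have lnL0 : 0 <= ln N%:R / L.
  rewrite divr_ge0 ?(ltW L0)// (le_trans _ lnN)// mulr_ge0 ?(ltW L0)//.
  by rewrite !addr_ge0// mulr_ge0// invr_ge0 ltW.
have /andP[kle klt] := truncn_itv lnL0.
set k1 := Num.truncn (ln N%:R / L) in kle klt.
have lnNL : k0%:R + 1 + 2 * L^-1 <= ln N%:R / L by rewrite ler_pdivlMr.
have Li0 : 0 < L^-1 by rewrite invr_gt0.
have k01 : (k0 < k1)%N.
  by rewrite truncn_gt_nat -natr1; lra.
(* The block index is one less than the integer part, because [u k] is [k + 1] times [L]. *)
case: k1 => [//|k] in kle klt k01 *.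
have uk_le : u k <= ln N%:R by rewrite -ler_pdivlMr.
have ukS_gt : ln N%:R < u k.+1 by rewrite -ltr_pdivrMr.
have Nn : (N <= n k)%N.
  rewrite truncn_ge_nat ?expR_ge0//.
  by rewrite -[N%:R]lnK ?posrE// ler_expR ltW.
have uk1 : 1 < u k.
  move: klt; rewrite ltr_pdivrMr// -natr1 mulrDl mul1r => klt.
  move: lnN; rewrite !mulrDl -mulrA mulVf ?gt_eqF// mulr1 mul1r.
  have := @mulr_ge0 R k0%:R L (ler0n _ _) (ltW L0).
  rewrite /u; lra.
have xk0 : 0 < x k by rewrite mulr_gt0// sqrtr_gt0 mulr_gt0 ?expR_gt0// ln_gt0.
have {Fk0} := Fk0 k k01.
have [//|[_ wx] _] := stopped_walkP X psi (n k) w xk0.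
rewrite (le_trans (ltW (wx _ Nn)))// /x.
apply: lil_level_le => //; [exact: ltW|exact: ltW|].
by rewrite -[leRHS]lnK ?posrE// ler_expR.
Unshelve. all: by end_near. Qed.
End upper_lil.

(* When [a = b = v], the choice [s1 = c1 / v], [s2 = c2 / v] and [tau] their
   midpoint gives both exponents the margin [(c2 - c1)^2 / (8 v)]. *)
Lemma lower_tail_exponents (R : realType) (v c1 : R) :
  0 < v -> 0 < c1 -> c1 ^+ 2 < 2 * v ->
  exists a b tau s1 s2 c2 g : R,
    [/\ 0 <= a < v, v < b, [/\ 0 <= s1, s1 <= tau, tau <= s2 & c1 <= c2], 0 < g &
     [/\ b * s1 ^+ 2 / 2 + (tau - s1) * c1 <= a * tau ^+ 2 / 2 - g,
      b * s2 ^+ 2 / 2 - (s2 - tau) * c2 <= a * tau ^+ 2 / 2 - g &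
      tau * c2 - a * tau ^+ 2 / 2 <= 1]].
Proof.
move=> v0 c10 c1v.
(* The upper edge of the window, with $c_1 < c_2 < \sqrt{2v}$; the second inequality provides the
   slack [h] used in the last bound. *)
pose c2 := Num.sqrt ((c1 ^+ 2 + 2 * v) / 2).
have c20 : 0 <= c2 by exact: sqrtr_ge0.
have c22 : c2 ^+ 2 = (c1 ^+ 2 + 2 * v) / 2.
  by rewrite sqr_sqrtr// divr_ge0// addr_ge0 ?sqr_ge0 ?mulr_ge0 ?(ltW v0).
have c12 : c1 < c2.
  by rewrite -(@ltr_pXn2r _ 2) ?nnegrE ?(ltW c10)// c22; lra.
have c2v : c2 ^+ 2 < 2 * v by rewrite c22; lra.
clearbody c2.
pose s1 := c1 / v; pose s2 := c2 / v; pose tau := (s1 + s2) / 2.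
have s1E : c1 = v * s1 by rewrite /s1 mulrC divfK ?gt_eqF.
have s2E : c2 = v * s2 by rewrite /s2 mulrC divfK ?gt_eqF.
have s10 : 0 < s1 by rewrite divr_gt0.
have s12 : s1 < s2 by rewrite ltr_pM2r ?invr_gt0.
clearbody s1 s2.
have s20 : 0 < s2 by lra.
(* Half of the margin available when $a = b = v$. The other half pays for replacing [v] by [v - e]
   and [v + e], which costs at most [e * s2 ^+ 2]. *)
pose g := v * (s2 - s1) ^+ 2 / 16.
have g0 : 0 < g by rewrite divr_gt0// mulr_gt0// exprn_gt0// subr_gt0.
have h0 : 0 < 1 - c2 ^+ 2 / (2 * v).
  by rewrite subr_gt0 ltr_pdivrMr ?mulr_gt0// mul1r.
pose h := 1 - v * s2 ^+ 2 / 2.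
have hE : 1 - c2 ^+ 2 / (2 * v) = h by rewrite /h s2E; field; rewrite gt_eqF.
rewrite {}hE in h0.
have gE : g = v * (s2 - s1) ^+ 2 / 16 by [].
have hE : h = 1 - v * s2 ^+ 2 / 2 by [].
clearbody g h.
pose e := Num.min (v / 2) (Num.min (g / s2 ^+ 2) (h / s2 ^+ 2)).
have s220 : 0 < s2 ^+ 2 by rewrite exprn_gt0.
have e0 : 0 < e by rewrite !lt_min !divr_gt0.
have : e <= e by [].
rewrite {2}/e !le_min !ler_pdivlMr// => /and3P[ev eg eh].
clearbody e.
have tau1 : s1 <= tau by rewrite /tau; lra.
have tau2 : tau <= s2 by rewrite /tau; lra.
have tau22 : tau ^+ 2 <= s2 ^+ 2.
  have tau0 : 0 <= tau by rewrite /tau; lra.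
  by rewrite lerXn2r ?nnegrE ?tau0 ?(ltW s20).
have s122 : s1 ^+ 2 <= s2 ^+ 2 by rewrite lerXn2r ?nnegrE ?(ltW s10) ?(ltW s20) ?(ltW s12).
have etau : e * tau ^+ 2 <= e * s2 ^+ 2 by rewrite ler_wpM2l// ltW.
have es1 : e * s1 ^+ 2 <= e * s2 ^+ 2 by rewrite ler_wpM2l// ltW.
exists (v - e), (v + e), tau, s1, s2, c2, g; split => //; first by apply/andP; lra.
- by lra.
- by split => //; exact: ltW.
have E1 : v * s1 ^+ 2 / 2 + (tau - s1) * c1 = v * tau ^+ 2 / 2 - 2 * g.
  by rewrite s1E /tau gE; field.
have E2 : v * s2 ^+ 2 / 2 - (s2 - tau) * c2 = v * tau ^+ 2 / 2 - 2 * g.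
  by rewrite s2E /tau gE; field.
have E3 : tau * c2 - v * tau ^+ 2 / 2 = 1 - h - 2 * g.
  by rewrite s2E /tau gE hE; field.
by split; rewrite ?mulrDl ?mulrBl; lra.
Qed.

(** * Exponential moments of a block, weighted by the past *)

Section lower_lil.
Context (R : realType) (d : measure_display) (Omega : measurableType d)
  (P : probability Omega R) (X : nat -> {RV P >-> R}).
Hypothesis indepX : mutually_independent P (fun i => (X i : Omega -> R)).
Context (psi : R -> R) (K v : R).
Hypotheses (mpsi : measurable_fun setT psi) (psiK : forall x, `|psi x| <= K).
Hypotheses (K_gt0 : 0 < K) (psi_mean : forall i, \int[P]_w psi (X i w) = 0).
Hypothesis psi_var : forall i, \int[P]_w (psi (X i w) ^+ 2) = v.

Let M t i := \int[P]_w expR (t * psi (X i w)).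

(** The weight [g] will be the indicator of a past event; a bound valid for every such weight
    replaces conditioning on the past. *)
Lemma weighted_mgf_walk_le (g : Omega -> R) (Kg : R) a l t b :
  measurable_fun setT (g : past X a -> R) -> (forall w, 0 <= g w <= Kg) ->
  (forall i, M t i <= expR b) ->
  \int[P]_w (g w * expR (t * walk X psi a l w)) <= \int[P]_w g w * expR (l%:R * b).
Proof.
move=> mg gK Mb; elim: l => [|l ih].
  rewrite mul0r expR0 mulr1 le_eqVlt; apply/orP; left; apply/eqP.
  by apply: eq_Rintegral => w _; rewrite walk0 mulr0 expR0 mulr1.
rewrite (Rintegral_expR_walkS indepX mpsi psiK _ _ mg gK).
rewrite -natr1 mulrDl mul1r expRD mulrA ler_pM//.
- by apply: Rintegral_ge0 => w _; rewrite mulr_ge0 ?expR_ge0//; have /andP[] := gK w.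
- by apply: Rintegral_ge0 => w _; exact: expR_ge0.
- exact: Mb.
Qed.

Lemma weighted_mgf_walk_ge (g : Omega -> R) (Kg : R) a l t b :
  measurable_fun setT (g : past X a -> R) -> (forall w, 0 <= g w <= Kg) ->
  (forall i, expR b <= M t i) ->
  \int[P]_w g w * expR (l%:R * b) <= \int[P]_w (g w * expR (t * walk X psi a l w)).
Proof.
move=> mg gK Mb; elim: l => [|l ih].
  rewrite mul0r expR0 mulr1 le_eqVlt; apply/orP; left; apply/eqP.
  by apply: eq_Rintegral => w _; rewrite walk0 mulr0 expR0 mulr1.
rewrite (Rintegral_expR_walkS indepX mpsi psiK _ _ mg gK).
rewrite -natr1 mulrDl mul1r expRD mulrA ler_pM//.
- rewrite mulr_ge0 ?expR_ge0//.
  by apply: Rintegral_ge0 => w _; have /andP[] := gK w.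
- exact: Mb.
Qed.

(* Splits [E exp(t D)] into two tails, bounded with parameters [s < t < s'], and
   the window [x <= D <= y], where [exp(t D) <= exp(t y)]. *)
Lemma expR_three_terms (t s s' D x y : R) : 0 <= s -> s <= t -> t <= s' -> x <= y ->
  expR (t * D) <= expR ((t - s) * x) * expR (s * D) +
    expR (- ((s' - t) * y)) * expR (s' * D) + expR (t * y) * (x <= D)%R%:R.
Proof.
move=> s0 st ts xy; rewrite -!expRD; have [xD|Dx] := leP x D; last first.
  rewrite mulr0 addr0 -[leLHS]addr0 lerD ?expR_ge0// ler_expR.
  have : (t - s) * D <= (t - s) * x by rewrite ler_wpM2l ?subr_ge0// ltW.
  lra.
rewrite mulr1; have [Dy|yD] := leP D y.
  rewrite -[leLHS]add0r lerD ?addr_ge0 ?expR_ge0// ler_expR ler_wpM2l//.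
  exact: le_trans st.
rewrite -[leLHS]addr0 lerD ?expR_ge0// -[leLHS]add0r lerD ?expR_ge0// ler_expR.
have : (s' - t) * y <= (s' - t) * D by rewrite ler_wpM2l ?subr_ge0// ltW.
lra.
Qed.

End lower_lil.

(** * Conditional lower bound for the tail of one block *)

Section lower_lil_blocks.
Context (R : realType) (d : measure_display) (Omega : measurableType d)
  (P : probability Omega R) (X : nat -> {RV P >-> R}).
Hypothesis indepX : mutually_independent P (fun i => (X i : Omega -> R)).
Context (psi : R -> R) (K v : R).
Hypotheses (mpsi : measurable_fun setT psi) (psiK : forall x, `|psi x| <= K).
Hypotheses (K_gt0 : 0 < K) (psi_mean : forall i, \int[P]_w psi (X i w) = 0).
Hypothesis psi_var : forall i, \int[P]_w (psi (X i w) ^+ 2) = v.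


Lemma fine_probE (A : set Omega) : measurable A -> fine (P A) = \int[P]_w \1_A w.
Proof. by move=> mA; rewrite fine_probability. Qed.

(** With $r = \sqrt{\lambda/n}$ every tilt has the form $zr$, and $r\sqrt{n\lambda} = \lambda$, so
    all exponents are multiples of $\lambda$. The tilted moment is at least $P(A)\exp(\lambda
    a\tau^2/2)$, each tail is smaller than this by a factor $e^{-g\lambda}$, and the rest lies in
    the window, where $\exp(\tau r D) \le \exp(\tau c_2\lambda)$. Since $\tau c_2 - a\tau^2/2 \le
    1$, the window carries at least $P(A)e^{-\lambda}/2$. *)
Lemma block_tail (c1 : R) : 0 < v -> 0 < c1 -> c1 ^+ 2 < 2 * v ->
  exists rho lam0 r0 : R, [/\ 0 <= rho < 1, 0 < r0 &
  forall m l (A : set Omega) (n lam : R),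
    measurable (A : set (past X m)) -> 0 < n -> rho * n <= l%:R <= n ->
    0 <= lam -> lam0 <= lam -> Num.sqrt (lam / n) <= r0 ->
    fine (P A) * (expR (- lam) / 2) <=
    fine (P (A `&` [set w | c1 * Num.sqrt (n * lam) <= walk X psi m l w]))].
Proof.
move=> v0 c10 c1v.
have [a [b [tau [s1 [s2 [c2 [g [/andP[a0 av] vb [s10 s1t ts2 c12] g0 [E1 E2 E3]]]]]]]]] :=
  lower_tail_exponents v0 c10 c1v.
(* The lower moment bound is used with [a'] strictly between [a] and [v], so that a block of length
   at least $(a/a')n$ still yields the exponent belonging to [a]. *)
pose a' := (a + v) / 2.
have a'0 : 0 < a' by rewrite /a'; lra.
have aa' : a < a' by rewrite /a'; lra.
have a'v : a' < v by rewrite /a'; lra.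
clearbody a'.
have [ta ta0 mgfa] := mgf_ge P K_gt0 (ltW a'0) a'v.
have [tb tb0 mgfb] := mgf_le P K_gt0 vb.
have tau0 : 0 <= tau by exact: le_trans s1t.
have s20 : 0 <= s2 by exact: le_trans ts2.
have b0 : 0 < b by lra.
(* For [lam] at least [ln 4 / g] each tail is at most a quarter of the lower bound for the tilted
   moment. The last constant keeps every tilt $zr$ with $z \le s_2$ within both moment bounds; its
   [+ 1] ensures a positive denominator from $s_2 \ge 0$ alone. *)
exists (a / a'), (ln 4 / g), (Num.min ta tb / (s2 + 1)); split.
- by rewrite divr_ge0 ?(ltW a'0)//= ltr_pdivrMr// mul1r.
- by rewrite divr_gt0 ?lt_min ?ta0// ltr_wpDl.
move=> m l A n lam mA n0 /andP[ln1 ln2] lam_ge0 lam_ge r_le.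
have mA' : measurable A := past_measurable mA.
set r := Num.sqrt (lam / n) in r_le.
have r_ge0 : 0 <= r by exact: sqrtr_ge0.
have r2 : r ^+ 2 = lam / n by rewrite sqr_sqrtr// divr_ge0// ltW.
pose x := c1 * Num.sqrt (n * lam); pose y := c2 * Num.sqrt (n * lam).
rewrite -/x.
have rsq : r * Num.sqrt (n * lam) = lam.
  rewrite -sqrtrM ?divr_ge0 ?(ltW n0)// (_ : _ / _ * _ = lam ^+ 2).
    by rewrite sqrtr_sqr ger0_norm.
  by field; rewrite gt_eqF.
have rx : r * x = c1 * lam by rewrite /x mulrCA rsq.
have ry : r * y = c2 * lam by rewrite /y mulrCA rsq.
have xy : x <= y by rewrite ler_wpM2r ?sqrtr_ge0.
have r_le_t z : 0 <= z -> z <= s2 -> z * r <= Num.min ta tb.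
  move=> z0 zs; apply: (@le_trans _ _ ((s2 + 1) * r)).
    by rewrite ler_wpM2r// (le_trans zs)// lerDl.
  by rewrite mulrC -ler_pdivlMr// ltr_wpDl.
pose G : R := fine (P A).
have G0 : 0 <= G by rewrite fine_ge0.
have GE : G = \int[P]_w \1_A w by exact: fine_probE.
have mg : measurable_fun setT (\1_A : past X m -> R) by exact: measurable_indic.
have gK w : 0 <= (\1_A w : R) <= 1.
  by rewrite indicE ler0n lern1 leq_b1.
clearbody x y.
have up z : 0 <= z -> z <= s2 ->
    \int[P]_w (\1_A w * expR (z * r * walk X psi m l w)) <=
    G * expR (lam * (b * z ^+ 2 / 2)).
  move=> z0 zs; have [zta ztb] : z * r <= ta /\ z * r <= tb.
    by apply/andP; rewrite -le_min r_le_t.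
  have Mb i : \int[P]_w expR (z * r * psi (X i w)) <= expR (b * (z * r) ^+ 2 / 2).
    apply: (mgfb (psi \o X i)) => //=.
    - exact: measurableT_comp.
    - by rewrite psi_var.
    - by rewrite mulr_ge0.
  have := weighted_mgf_walk_le indepX mpsi psiK l mg gK Mb.
  move=> /le_trans; apply.
  rewrite -GE ler_wpM2l// ler_expR exprMn r2.
  rewrite (_ : _ * _ = (l%:R / n) * (lam * (b * z ^+ 2 / 2))); last first.
    by field; rewrite gt_eqF.
  rewrite ler_piMl//; last by rewrite ler_pdivrMr ?mul1r.
  by rewrite mulr_ge0// divr_ge0// mulr_ge0 ?(ltW b0)// sqr_ge0.
have lo : G * expR (lam * (a * tau ^+ 2 / 2)) <=
    \int[P]_w (\1_A w * expR (tau * r * walk X psi m l w)).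
  have [zta ztb] : tau * r <= ta /\ tau * r <= tb.
    by apply/andP; rewrite -le_min r_le_t.
  have Mb i : expR (a' * (tau * r) ^+ 2 / 2) <= \int[P]_w expR (tau * r * psi (X i w)).
    apply: (mgfa (psi \o X i)) => //=.
    - exact: measurableT_comp.
    - by rewrite psi_var.
    - by rewrite mulr_ge0.
  have := weighted_mgf_walk_ge indepX mpsi psiK l mg gK Mb.
  apply: le_trans.
    rewrite -GE ler_wpM2l// ler_expR exprMn r2.
    rewrite (_ : _%:R * _ = (a' * l%:R / n) * (lam * (tau ^+ 2 / 2))); last first.
      by field; rewrite gt_eqF.
    rewrite (_ : lam * _ = a * (lam * (tau ^+ 2 / 2))); last by ring.
    rewrite ler_wpM2r ?mulr_ge0 ?divr_ge0 ?sqr_ge0//.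
    rewrite ler_pdivlMr//; move: ln1.
    by rewrite mulrAC ler_pdivrMr// [l%:R * _]mulrC.
pose B := [set w | x <= walk X psi m l w].
have mW := measurable_walk X mpsi m l.
have mB : measurable B.
  rewrite -[B]setTI; exact: measurable_fun_ler.
have mAB : measurable (A `&` B) by exact: measurableI.
pose e1 : R := expR ((tau - s1) * r * x).
pose e2 : R := expR (- ((s2 - tau) * r * y)).
pose e3 : R := expR (tau * r * y).
pose D w := walk X psi m l w.
have key : \int[P]_w (\1_A w * expR (tau * r * D w)) <=
    e1 * \int[P]_w (\1_A w * expR (s1 * r * D w)) +
    e2 * \int[P]_w (\1_A w * expR (s2 * r * D w)) + e3 * fine (P (A `&` B)).
  have iA z : P.-integrable setT (EFin \o (fun w => \1_A w * expR (z * D w))).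
    apply: (@bounded_integrable _ _ _ _ _ (expR (`|z| * (l%:R * K)))).
      apply: measurable_funM; first exact: measurable_indic.
      exact: measurable_expRM.
    move=> w; have /andP[g1 g2] := gK w; rewrite normrM ger0_norm//.
    rewrite -[leRHS]mul1r ler_pM//.
    exact: (bounded_expRM _ (normr_walk X psiK m l)).
  have iAB : P.-integrable setT (EFin \o (\1_(A `&` B) : Omega -> R)).
    apply: (@bounded_integrable _ _ _ _ _ 1); first exact: measurable_indic.
    by move=> w; rewrite indicE; case: (_ \in _); rewrite ?normr1 ?normr0.
  have iZ c f : P.-integrable setT (EFin \o f) ->
      P.-integrable setT (EFin \o (fun w => c * f w)).
    by move=> hf; exact: (integrableZl measurableT c hf).
  rewrite fine_probE// -!RintegralZl//.
  rewrite -RintegralD//; [|exact: iZ|exact: iZ].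
  rewrite -RintegralD//; [|by apply: integrable_EFinD; exact: iZ|exact: iZ].
  apply: le_Rintegral => //.
    by apply: integrable_EFinD; [apply: integrable_EFinD|]; exact: iZ.
  move=> w _; rewrite !indicE in_setI.
  have [wA|wA] := boolP (w \in A); last by rewrite !mul0r !mulr0 !addr0.
  rewrite !mul1r (_ : (w \in B) = (x <= D w)); last first.
    by apply/idP/idP => [/set_mem//|h]; exact/mem_set.
  rewrite /e1 /e2 ![(_ - _) * r]mulrBl; apply: expR_three_terms => //.
  - by rewrite mulr_ge0.
  - by rewrite ler_wpM2r.
  - by rewrite ler_wpM2r.
rewrite -/G -/B.
set p := fine (P (A `&` B)) in key *.
have p1 : G * expR (lam * (a * tau ^+ 2 / 2)) <=
    2 * G * expR (lam * (a * tau ^+ 2 / 2 - g)) + e3 * p.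
  apply: (le_trans lo); apply: (le_trans key); rewrite lerD2r.
  rewrite -mulrA mulr_natl mulr2n lerD//.
    apply: (@le_trans _ _ (e1 * (G * expR (lam * (b * s1 ^+ 2 / 2))))).
      by rewrite ler_wpM2l ?expR_ge0// up// (le_trans s1t).
    rewrite mulrCA ler_wpM2l// /e1 -expRD ler_expR -mulrA rx.
    have := ler_wpM2l lam_ge0 E1; rewrite !mulrDr; lra.
  apply: (@le_trans _ _ (e2 * (G * expR (lam * (b * s2 ^+ 2 / 2))))).
    by rewrite ler_wpM2l ?expR_ge0// up.
  rewrite mulrCA ler_wpM2l// /e2 -expRD ler_expR -mulrA ry.
  have := ler_wpM2l lam_ge0 E2; rewrite !mulrDr; lra.
have eg : expR (- (g * lam)) <= 4^-1.
  rewrite expRN lef_pV2 ?posrE ?expR_gt0//.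
  by rewrite -[leLHS]lnK ?posrE// ler_expR mulrC -ler_pdivrMr.
have e3E : e3 = expR (lam * (tau * c2)).
  by rewrite /e3 -mulrA ry; congr expR; ring.
rewrite (_ : lam * (a * tau ^+ 2 / 2 - g) = lam * (a * tau ^+ 2 / 2) + - (g * lam)) in p1; last by ring.
rewrite expRD in p1.
set E := expR (lam * (a * tau ^+ 2 / 2)) in p1.
have E0 : 0 < E by exact: expR_gt0.
have p2 : G * E / 2 <= e3 * p.
  have : G * E * expR (- (g * lam)) <= G * E * 4^-1.
    by rewrite ler_wpM2l// mulr_ge0// ltW.
  lra.
rewrite -(ler_pM2l (expR_gt0 (lam * (tau * c2)))) -e3E (le_trans _ p2)//.
rewrite mulrCA -!mulrA ler_wpM2l// mulrA ler_pM2r ?invr_gt0//.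
rewrite e3E -expRD ler_expR.
have := ler_wpM2l lam_ge0 E3; lra.
Qed.

End lower_lil_blocks.

(** * Lower half of the law of the iterated logarithm along geometric blocks *)

Section lower_lil.
Context (R : realType) (d : measure_display) (Omega : measurableType d)
  (P : probability Omega R) (X : nat -> {RV P >-> R}).
Hypothesis indepX : mutually_independent P (fun i => (X i : Omega -> R)).
Context (psi : R -> R) (K v : R).
Hypotheses (mpsi : measurable_fun setT psi) (psiK : forall x, `|psi x| <= K).
Hypotheses (K_gt0 : 0 < K) (psi_mean : forall i, \int[P]_w psi (X i w) = 0).

Lemma upper_lilN (c : R) : (forall i, \int[P]_w (psi (X i w) ^+ 2) <= v) ->
  0 < c -> 2 * v < c ^+ 2 ->
  {ae P, forall w, \forall n \near \oo,
    - (c * Num.sqrt (n%:R * ln (ln n%:R))) <= walk X psi 0 n w}.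
Proof.
move=> psi_var c0 vc.
have walkN n w : walk X (fun x => - psi x) 0 n w = - walk X psi 0 n w.
  by rewrite /walk sumrN.
have mX i : measurable_fun setT (fun w => psi (X i w)) by exact: measurableT_comp.
have mN : measurable_fun setT (fun x => - psi x) by exact: measurableT_comp.
have KN x : `|- psi x| <= K by rewrite normrN.
have meanN i : \int[P]_w (- psi (X i w)) = 0.
  under eq_Rintegral do rewrite -mulN1r.
  rewrite RintegralZl ?psi_mean ?mulr0//.
  exact: (@bounded_integrable _ _ _ _ _ K).
have varN i : \int[P]_w ((- psi (X i w)) ^+ 2) <= v.
  by under eq_Rintegral do rewrite sqrrN.
have := upper_lil indepX mN KN K_gt0 meanN varN c0 vc.
apply: filterS => w; apply: filterS => n.
by rewrite walkN lerNl.
Qed.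

Hypothesis psi_var : forall i, \int[P]_w (psi (X i w) ^+ 2) = v.

(* The complement of infinitely many block events has probability zero: the
   product of [1 - kappa / (k + 2)] telescopes against powers of [k + 2]. *)
Lemma avoid_blocks_le (B : nat -> set Omega) (m : nat -> nat) (kappa : R) (k0 : nat) :
  0 < kappa ->
  (forall k, (m k <= m k.+1)%N) ->
  (forall k, measurable (B k : set (past X (m k.+1)))) ->
  (forall k (A : set Omega), (k0 <= k)%N -> measurable (A : set (past X (m k))) ->
    fine (P A) * (kappa / k.+2%:R) <= fine (P (A `&` B k))) ->
  {ae P, forall w, forall N, exists2 k, (N <= k)%N & B k w}.
Proof.
move=> kappa0 m_le mB HB.
apply: ae_foralln => N.
pose k1 := maxn k0 N.
(* [A j] is the event that none of the [j] blocks from [k1] on succeeds. It belongs to the past of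
   block [k1 + j], so the hypothesis on [B] applies to it at every stage. *)
pose A := fix A j := if j is j'.+1 then A j' `\` B (k1 + j')%N else setT : set Omega.
have mA j : measurable (A j : set (past X (m (k1 + j)%N))).
  elim: j => [|j ih] /=; first exact: measurableT.
  rewrite addnS; apply: measurableD; last exact: mB.
  exact: past_leq (m_le _) ih.
have mA' j : measurable (A j) := past_measurable (mA j).
have mB' k : measurable (B k) := past_measurable (mB k).
have finP (S : set Omega) : measurable S -> P S \is a fin_num.
  by move=> mS; exact: fin_num_measure.
have PA j : fine (P (A j)) <=
    expR (- kappa * (ln (k1 + j).+2%:R - ln k1.+2%:R)).
  elim: j => [|j ih].
    by rewrite addn0 subrr mulr0 expR0 /= probability_setT.
  have stepE : fine (P (A j)) = fine (P (A j.+1)) + fine (P (A j `&` B (k1 + j)%N)).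
    rewrite -fineD; [|by apply: finP|by apply: finP; exact: measurableI].
    by rewrite -measureDI//.
  have := HB (k1 + j)%N (A j) _ (mA j).
  rewrite (leq_trans (leq_maxl _ _) (leq_addr _ _)) => /(_ isT) h.
  set k := (k1 + j)%N in ih h stepE *.
  have p1 : fine (P (A j.+1)) <= fine (P (A j)) * (1 - kappa / k.+2%:R).
    by rewrite mulrBr mulr1 lerBrDr [leRHS]stepE lerD2l.
  apply: (le_trans p1).
  apply: (@le_trans _ _ (fine (P (A j)) * expR (- (kappa / k.+2%:R)))).
    by rewrite ler_wpM2l ?fine_ge0// expR_ge1Dx.
  apply: (@le_trans _ _ (expR (- kappa * (ln k.+2%:R - ln k1.+2%:R)) *
      expR (- (kappa / k.+2%:R)))).
    by rewrite ler_wpM2r ?expR_ge0.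
  rewrite -expRD ler_expR addnS -/k.
  have lnk : ln k.+3%:R - ln k.+2%:R <= k.+2%:R^-1 :> R.
    rewrite -ln_div ?posrE// -[k.+3%:R]natr1 mulrDl divff ?gt_eqF// mul1r.
    by rewrite le_ln1Dx// (lt_trans (ltrN10 _))// invr_gt0.
  have := ler_wpM2l (ltW kappa0) lnk.
  move: (ln k.+3%:R) (ln k.+2%:R) (ln k1.+2%:R) (k.+2%:R^-1) => x y z i.
  by lra.
exists (\bigcap_j A j); split.
- exact: bigcapT_measurable.
- apply/eqP; rewrite eq_le measure_ge0 andbT; apply/lee_addgt0Pr => e e0.
  rewrite add0e.
  have [j _ /(_ j (leqnn _)) je] := near_le_ln_natM (ln k1.+2%:R - ln e / kappa) (@ltr01 R).
  rewrite mulr1 in je.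
  apply: (@le_trans _ _ (P (A j))).
    apply: le_measure; rewrite ?inE//; first exact: bigcapT_measurable.
    exact: bigcap_inf.
  rewrite -[P (A j)]fineK ?finP// lee_fin (le_trans (PA j))//.
  rewrite -[leRHS]lnK ?posrE// ler_expR.
  have je' : ln j.+1%:R <= ln (k1 + j).+2%:R :> R.
    by rewrite ler_ln ?posrE// ler_nat ltnS leqW// leq_addl.
  rewrite mulNr lerNl -ler_pdivrMl//.
  by rewrite mulrC mulNr; lra.
- move=> w /= nB j _.
  elim: j => [//|j ih] /=; split => // Bw; apply: nB.
  by exists (k1 + j)%N => //; rewrite (leq_trans (leq_maxr k0 _))// leq_addr.
Qed.

(** Blocks end at powers of [Q]. A successful block contributes [c1] times the level at its end,
    while the sum before it is at worst [- C] times a level smaller by the factor $\sqrt Q$. The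
    condition $C \le (c_1 - c)\sqrt Q$ leaves the constant [c]. *)
Lemma lower_lil (c : R) : 0 < v -> 0 < c -> c ^+ 2 < 2 * v ->
  {ae P, forall w, forall N, exists2 n, (N <= n)%N &
    c * Num.sqrt (n%:R * ln (ln n%:R)) <= walk X psi 0 n w}.
Proof.
move=> v0 c0 cv.
pose c1 := Num.sqrt ((c ^+ 2 + 2 * v) / 2).
have c12 : c1 ^+ 2 = (c ^+ 2 + 2 * v) / 2.
  by rewrite sqr_sqrtr// divr_ge0// addr_ge0 ?sqr_ge0 ?mulr_ge0 ?(ltW v0).
have cc1 : c < c1.
  by rewrite -(@ltr_pXn2r _ 2) ?nnegrE ?sqrtr_ge0 ?(ltW c0)// c12; lra.
have c1v : c1 ^+ 2 < 2 * v by rewrite c12; lra.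
have c10 : 0 < c1 by exact: lt_trans cc1.
clearbody c1.
have [rho [lam0 [r0 [/andP[rho0 rho1] r00 tail]]]] :=
  block_tail indepX mpsi psiK K_gt0 psi_mean psi_var v0 c10 c1v.
pose C := 2 * v + 1.
have C0 : 0 < C by rewrite /C; lra.
have C2 : 2 * v < C ^+ 2.
  have : 0 <= v ^+ 2 by exact: sqr_ge0.
  have -> : C ^+ 2 = 4 * v ^+ 2 + 4 * v + 1 by rewrite /C; ring.
  by lra.
clearbody C.
have dc0 : 0 < c1 - c by rewrite subr_gt0.
(* The first summand makes each block fill the fraction [rho] of the time at its end; the second
   makes [c1 - c] absorb the sum before the block. *)
pose b0 := (1 - rho)^-1 + (C / (c1 - c)) ^+ 2.
pose Q := (Num.truncn b0).+2.
have QR0 : 0 < Q%:R :> R by rewrite ltr0n.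
have b0Q : b0 <= Q%:R.
  by rewrite ltW// (lt_trans (truncnS_gt b0))// ltr_nat.
have i1 : 0 < (1 - rho)^-1 by rewrite invr_gt0 subr_gt0.
have i2 : 0 <= (C / (c1 - c)) ^+ 2 by exact: sqr_ge0.
have rhoQ : rho * Q%:R <= Q%:R - 1.
  have : (1 - rho)^-1 <= Q%:R by move: b0Q; rewrite /b0; lra.
  rewrite -[leLHS]mul1r ler_pdivrMr ?subr_gt0//; lra.
have CQ : C <= (c1 - c) * Num.sqrt Q%:R.
  rewrite mulrC -ler_pdivrMr// -[leLHS]ger0_norm; last first.
    by rewrite divr_ge0 ?(ltW C0) ?(ltW dc0).
  by rewrite -sqrtr_sqr ler_wsqrtr//; move: b0Q; rewrite /b0; lra.
pose L : R := ln Q%:R.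
have L0 : 0 < L by rewrite ln_gt0// ltr1n.
have lnQ k : ln (Q ^ k)%N%:R = k%:R * L.
  by rewrite natrX lnXn// mulr_natl.
have expQ k : (Q ^ k)%N%:R = expR (k%:R * L).
  by rewrite -lnQ lnK// posrE ltr0n expn_gt0.
have Qgt0 k : 0 < (Q ^ k)%N%:R :> R by rewrite ltr0n expn_gt0.
clearbody L.
pose m k := (Q ^ k.+1)%N.
pose l k := (m k.+1 - m k)%N.
have mS k : m k.+1 = (m k + l k)%N.
  by rewrite /l subnKC// leq_pexp2l.
pose lam k : R := ln (k.+2%:R * L).
pose B k := [set w | c1 * Num.sqrt ((m k.+1)%:R * lam k) <= walk X psi (m k) (l k) w].
have ae_B : {ae P, forall w, forall N, exists2 k, (N <= k)%N & B k w}.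
  have [k0 _ Hk0] : \forall k \near \oo, [/\ 1 <= k.+1%:R * L,
      2 / r0 ^+ 2 <= k.+1%:R * L & lam0 <= ln (k.+1%:R * L)].
    near=> k; split; near: k; [exact: near_le_natSM|exact: near_le_natSM|].
    exact: near_le_ln_natM.
  (* Since [lam k] is the iterated logarithm of the block end, [expR (- lam k) / 2] equals
     $1/(2L(k+2))$, the general term of a divergent series. *)
  apply: (@avoid_blocks_le B m (2 * L)^-1 k0).
  - by rewrite invr_gt0 mulr_gt0.
  - by move=> k; rewrite leq_pexp2l.
  - move=> k; rewrite mS -[B k]setTI.
    apply: (@measurable_fun_ler _ (past X (m k + l k))) => //.
    exact: measurable_past_walk.
  move=> k A k0k mA.
  have [h1 h2 h3] := Hk0 k k0k.
  have kk : k.+1%:R * L <= k.+2%:R * L by rewrite ler_pM2r// ler_nat.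
  have pos1 : 0 < k.+1%:R * L by rewrite mulr_gt0.
  have pos2 : 0 < k.+2%:R * L by rewrite mulr_gt0.
  have lam_le : ln (k.+1%:R * L) <= lam k by rewrite ler_ln ?posrE.
  have lam_ge0 : 0 <= lam k by rewrite ln_ge0// (le_trans h1).
  have := tail (m k) (l k) A (m k.+1)%:R (lam k) mA (Qgt0 _) _ lam_ge0
    (le_trans h3 lam_le) _.
  rewrite (_ : expR (- lam k) / 2 = (2 * L)^-1 / k.+2%:R); last first.
    by rewrite expRN lnK ?posrE//; field; rewrite !gt_eqF.
  apply.
    rewrite ler_nat leq_subr andbT natrB; last by rewrite leq_pexp2l.
    rewrite /m expnS [(Q * _)%N%:R]natrM.
    have := ler_wpM2r (ltW (Qgt0 k.+1)) rhoQ.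
    by rewrite mulrBl mul1r; lra.
  rewrite -[leRHS]ger0_norm ?(ltW r00)// -sqrtr_sqr ler_wsqrtr//.
  rewrite ler_pdivrMr; last exact: Qgt0.
  rewrite /m expQ /lam; apply: ln_le_eps_expR; first by rewrite exprn_gt0.
  exact: le_trans kk.
have psi_var_le i : \int[P]_w (psi (X i w) ^+ 2) <= v by rewrite psi_var.
have := upper_lilN psi_var_le C0 C2.
move: ae_B; apply: filterS2 => w Bw [N1 _ low] N.
have [k kN Bk] := Bw (maxn N N1).
have k_le : (k <= m k)%N.
  by rewrite /m (leq_trans (leqnSn k))// ltnW// ltn_expl.
have [Nk N1k] : (N <= k /\ N1 <= k)%N by apply/andP; rewrite -geq_max.
exists (m k.+1).
  by rewrite (leq_trans Nk)// (leq_trans k_le)// leq_pexp2l.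
have {low} := low (m k) (leq_trans N1k k_le).
rewrite [in X in _ -> X]mS walk_cat -mS => low.
rewrite !lnQ in low *.
apply: le_trans (lerD low Bk); rewrite -/(lam k).
set s := Num.sqrt _.
have lam_le : ln (k.+1%:R * L) <= lam k.
  by rewrite ler_ln ?posrE ?mulr_gt0// ler_pM2r// ler_nat.
have sE : s = Num.sqrt Q%:R * Num.sqrt ((m k)%:R * lam k).
  by rewrite -sqrtrM ?ltW// mulrA -natrM -expnS.
have h1 : C * Num.sqrt ((m k)%:R * ln (k.+1%:R * L)) <= C * Num.sqrt ((m k)%:R * lam k).
  by rewrite ler_wpM2l ?(ltW C0)// ler_wsqrtr// ler_wpM2l.
have h2 : C * Num.sqrt ((m k)%:R * lam k) <=
    (c1 - c) * Num.sqrt Q%:R * Num.sqrt ((m k)%:R * lam k).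
  by rewrite ler_wpM2r ?sqrtr_ge0.
rewrite -mulrA -sE in h2.
by lra.
Unshelve. all: by end_near. Qed.

End lower_lil.

(** * Densities and the strong law *)

Section density.
Context (R : realType) (d : measure_display) (T : measurableType d)
  (mu nu : {measure set T -> \bar R}) (p : T -> R).
Hypotheses (mp : measurable_fun setT p) (p0 : forall x, 0 <= p x).
Hypothesis nuE : forall A, measurable A -> nu A = (\int[mu]_(x in A) (p x)%:E)%E.
Local Open Scope ereal_scope.

Import HBNNSimple.

(** The hypothesis describes [nu] on sets only; simple functions and monotone convergence extend it
    to integrals. *)
Lemma ge0_integral_density (f : T -> \bar R) : (forall x, 0 <= f x) ->
  measurable_fun setT f -> \int[nu]_x f x = \int[mu]_x (f x * (p x)%:E).
Proof.
move=> f0 mf; pose h := nnsfun_approx measurableT mf.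
pose g x := (p x)%:E.
have mg : measurable_fun setT g by exact/measurable_EFinP.
have g0 x : 0 <= g x by rewrite lee_fin.
have -> : \int[nu]_x f x = lim (\int[nu]_x (EFin \o h n) x @[n --> \oo]).
  have fE x : f x = lim ((EFin \o h n) x @[n --> \oo]).
    by apply/esym/cvg_lim => //; exact: cvg_nnsfun_approx.
  under eq_integral do rewrite fE.
  apply: monotone_convergence => //.
  - by move=> n; exact/measurable_EFinP.
  - by move=> n x _; rewrite lee_fin.
  - by move=> x _ a b ab; rewrite lee_fin; exact/lefP/nd_nnsfun_approx.
have -> : \int[mu]_x (f x * g x) = lim (\int[mu]_x ((EFin \o h n) x * g x) @[n --> \oo]).
  have fgE x : f x * g x = lim (((EFin \o h n) x * g x) @[n --> \oo]).
    apply/esym/cvg_lim => //; apply: cvgeZr => //.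
    exact: cvg_nnsfun_approx.
  under eq_integral do rewrite fgE.
  apply: monotone_convergence => //.
  - by move=> n; apply/emeasurable_funM => //; exact/measurable_EFinP.
  - by move=> n x _; rewrite mule_ge0// lee_fin.
  - move=> x _ a b ab; rewrite lee_wpmul2r// lee_fin.
    exact/lefP/nd_nnsfun_approx.
apply: congr_lim; apply/funext => n.
transitivity (\int[nu]_x (\sum_(y \in range (h n)) (y * \1_(h n @^-1` [set y]) x)%:E)).
  by apply: eq_integral => t _; rewrite /= fimfunE -fsumEFin.
have indich m r : measurable_fun setT (fun x => (r * \1_(h m @^-1` [set r]) x)%:E).
  by apply: (measurable_comp measurableT) => //; exact: measurable_funM.
rewrite ge0_integral_fsum//; last by move=> m y _; exact: nnfun_muleindic_ge0.
transitivity (\int[mu]_x (\sum_(y \in range (h n))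
    (y * \1_(h n @^-1` [set y]) x)%:E * g x)); last first.
  under [LHS]eq_integral => x _.
    rewrite -ge0_mule_fsuml => [|y]; last exact: nnfun_muleindic_ge0.
    rewrite fsumEFin // -(fimfunE _ x); over.
  by [].
rewrite [RHS]ge0_integral_fsum//; last 2 first.
  - by move=> y; apply: emeasurable_funM.
  - by move=> m y _; rewrite mule_ge0// nnfun_muleindic_ge0.
apply: eq_fsbigr => r rhn.
under [LHS]eq_integral do rewrite EFinM.
rewrite integralZl_indic_nnsfun => //.
under [RHS]eq_integral do rewrite EFinM -muleA.
rewrite ge0_integralZl//.
- under [in RHS]eq_integral do rewrite muleC.
  rewrite [in RHS](eq_integral (g \_ (h n @^-1` [set r]))); last first.
    by move=> x _; rewrite epatch_indic.
  by rewrite -integral_mkcond -nuE// integral_indic// setIT.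
- by apply: emeasurable_funM => //; exact/measurable_EFinP.
- by move=> t _; rewrite mule_ge0 ?lee_fin.
- by move: rhn; rewrite inE => -[t _ <-]; rewrite lee_fin.
Qed.

Lemma integral_density (f : T -> R) : measurable_fun setT f ->
  \int[nu]_x (f x)%:E = \int[mu]_x (f x * p x)%:E.
Proof.
move=> mf; have mEf : measurable_fun setT (EFin \o f) by exact/measurable_EFinP.
rewrite [LHS]integralE [RHS]integralE; congr (_ - _).
  rewrite ge0_integral_density//; last exact: measurable_funepos.
  apply: eq_integral => x _.
  by rewrite !funeposE/= EFinM maxe_pMl ?lee_fin// mul0e.
rewrite ge0_integral_density//; last exact: measurable_funeneg.
apply: eq_integral => x _.
by rewrite !funenegE EFinM -mulNe maxe_pMl ?lee_fin// mul0e.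
Qed.

End density.

(** * Strong law of large numbers for bounded functions *)

Section bounded_slln.
Context (R : realType) (d : measure_display) (Omega : measurableType d)
  (P : probability Omega R) (X : nat -> {RV P >-> R}).
Hypothesis indepX : mutually_independent P (fun i => (X i : Omega -> R)).

Lemma bounded_slln (h : R -> R) (K e : R) :
  measurable_fun setT h -> (forall x, `|h x| <= K) ->
  (forall i, \int[P]_w h (X i w) = e) ->
  {ae P, forall w, forall eps, 0 < eps -> \forall n \near \oo,
    `|\sum_(i < n) h (X i w) - n%:R * e| <= eps * n%:R}.
Proof.
move=> mh hK he.
(* [K'] bounds [h - e], and the added 1 makes it positive. Its square bounds the variance, so
   [2 * K'] is an admissible constant for both signs of the iterated logarithm bound. *)
have K0 : 0 <= K by exact: le_trans (hK 0).
pose psi x := h x - e; pose K' := K + `|e| + 1.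
have K'0 : 0 < K' by rewrite ltr_wpDl// addr_ge0.
have mpsi : measurable_fun setT psi by exact: measurable_funB.
have psiK x : `|psi x| <= K'.
  rewrite (le_trans (ler_normB _ _))// (@le_trans _ _ (K + `|e|))//.
    by rewrite lerD2r.
  by rewrite lerDl.
have mhX i : measurable_fun setT (fun w => h (X i w)) by exact: measurableT_comp.
have psi_mean i : \int[P]_w psi (X i w) = 0.
  rewrite /psi RintegralB//.
  - by rewrite he bounded_Rintegral_cst subrr.
  - exact: (@bounded_integrable _ _ _ _ _ K).
  - by apply: (@bounded_integrable _ _ _ _ _ `|e|) => //; exact: measurable_cst.
have mpsi2 i : measurable_fun setT (fun w => psi (X i w) ^+ 2).
  by apply: measurable_funX; exact: measurableT_comp.
have psi2 i w : psi (X i w) ^+ 2 <= K' ^+ 2.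
  by rewrite -real_normK ?num_real// lerXn2r ?nnegrE// ltW.
have psi_var i : \int[P]_w (psi (X i w) ^+ 2) <= K' ^+ 2.
  rewrite -[leRHS](bounded_Rintegral_cst P); apply: le_Rintegral => //.
    apply: (@bounded_integrable _ _ _ _ _ (K' ^+ 2)) => // w.
    by rewrite ger0_norm ?sqr_ge0.
  apply: (@bounded_integrable _ _ _ _ _ (K' ^+ 2)); first exact: measurable_cst.
  by move=> w; rewrite ger0_norm ?sqr_ge0.
have C0 : 0 < 2 * K' by rewrite mulr_gt0.
have C2 : 2 * K' ^+ 2 < (2 * K') ^+ 2.
  have : 0 < K' ^+ 2 by rewrite exprn_gt0.
  by rewrite exprMn; lra.
have up := upper_lil indepX mpsi psiK K'0 psi_mean psi_var C0 C2.
have lo := upper_lilN indepX mpsi psiK K'0 psi_mean psi_var C0 C2.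
move: up lo; apply: filterS2 => w up lo eps eps0.
near=> n.
have n0 : 0 < n%:R :> R by rewrite ltr0n; near: n; exact: nbhs_infty_gt.
have walkE : walk X psi 0 n w = \sum_(i < n) h (X i w) - n%:R * e.
  by rewrite /walk sumrB sumr_const card_ord mulr_natl.
(* The deviation is at most [2 * K'] times $\sqrt{n\ln\ln n}$; this [b] makes $\ln\ln n \le bn$ for
   large [n], hence the deviation at most [eps * n]. *)
pose b := (eps / (2 * K')) ^+ 2.
have b0 : 0 < b by rewrite exprn_gt0// divr_gt0.
have nE : n%:R = expR (ln n%:R) :> R by rewrite lnK// posrE.
have ln_ge : 2 / b <= ln n%:R.
  rewrite -[leLHS]expRK ler_ln ?posrE ?expR_gt0//.
  by near: n; exact: nbhs_infty_ger.
have LLn : n%:R * ln (ln n%:R) <= (n%:R * (eps / (2 * K'))) ^+ 2.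
  rewrite exprMn expr2 -mulrA ler_pM2l// [leRHS]mulrC -/b {2}nE.
  exact: ln_le_eps_expR.
have sq : 2 * K' * Num.sqrt (n%:R * ln (ln n%:R)) <= eps * n%:R.
  rewrite -ler_pdivlMl// (le_trans (ler_wsqrtr LLn))// sqrtr_sqr ger0_norm.
    by rewrite le_eqVlt; apply/orP; left; apply/eqP; field; rewrite gt_eqF.
  by rewrite mulr_ge0 ?(ltW n0)// divr_ge0 ?(ltW eps0) ?(ltW C0).
rewrite -walkE ler_norml; apply/andP; split.
  by apply: le_trans (_ : - (2 * K' * Num.sqrt (n%:R * ln (ln n%:R))) <= _);
    [rewrite lerN2|near: n].
by apply: le_trans sq; near: n.
Unshelve. all: by end_near. Qed.

End bounded_slln.

(** * The Pearson type VII law *)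

Lemma derivable_oo_LRcontinuous_is_derive (R : realType) (F f : R -> R) (a b : R) :
  (forall x : R, is_derive x 1 F (f x)) -> derivable_oo_LRcontinuous F a b.
Proof.
move=> dF; have cF := is_derive1_continuous dF.
split; first by move=> x _; exact: ex_derive.
- by apply: cvg_at_right_filter; exact: cF.
- by apply: cvg_at_left_filter; exact: cF.
Qed.

(** The fundamental theorem of calculus on growing symmetric segments, then dominated convergence
    with the absolute value of [f] as majorant. *)
Lemma integral_derive_vanishing (R : realType) (F f : R -> R) :
  (forall x : R, is_derive x 1 F (f x)) -> continuous f ->
  (@lebesgue_measure R).-integrable setT (EFin \o f) ->
  F n.+1%:R @[n --> \oo] --> 0 -> F (- n.+1%:R) @[n --> \oo] --> 0 ->
  (\int[@lebesgue_measure R]_x (f x)%:E = 0)%E.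
Proof.
move=> dF cf intf F1 F2.
pose I n : set R := `[(- n.+1%:R), n.+1%:R]%classic.
pose f_ n := (EFin \o f) \_ (I n).
have mEf : measurable_fun setT (EFin \o f) by exact: measurable_int intf.
have [] := @dominated_convergence _ _ R (@lebesgue_measure R) setT measurableT
  f_ (EFin \o f) (abse \o (EFin \o f)) _ mEf _ _ _.
- move=> n; apply/(measurable_restrictT _ _).1; first exact: measurable_itv.
  exact: (measurable_funTS mEf).
- apply: aeW => x _; apply: cvg_near_cst; near=> n.
  rewrite /f_ patchE mem_set// /I/= in_itv/= -ler_norml.
  apply: (@le_trans _ _ n%:R); last by rewrite ler_nat.
  by near: n; exact: nbhs_infty_ger.
- exact: integrable_abse.
- apply: aeW => x n _; rewrite /f_ patchE; case: ifP => _ //=.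
  by rewrite normr0 lee_fin.
move=> _ _ lim1.
have lim2 : (\int[@lebesgue_measure R]_x (f_ n x))%E @[n --> \oo] --> 0%E.
  have -> : (fun n => \int[@lebesgue_measure R]_x (f_ n x))%E =
      EFin \o (fun n => F n.+1%:R - F (- n.+1%:R)).
    apply/funext => n /=; rewrite /f_ -integral_mkcond /I.
    rewrite (@continuous_FTC2 _ _ F) ?EFinB//.
    + by rewrite (@lt_trans _ _ 0)// oppr_lt0.
    + exact: continuous_subspaceT.
    + exact: derivable_oo_LRcontinuous_is_derive dF.
    + by move=> x _; rewrite derive1E derive_val.
  apply: cvg_EFin; first exact: nearW.
  by rewrite -(subr0 0); exact: cvgB.
exact: cvg_unique lim1 lim2.
Unshelve. all: by end_near. Qed.

(** * The kernel $1 + y^2$ and the normalized score *)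

Section pearson_functions.
Context (R : realType).
Implicit Types (m x y t : R).

Definition pq y := 1 + y ^+ 2.
(** Moments reduce to powers of [pw]: $y\phi = 1 - w$, $\phi^2 = w - w^2$ and $\phi' = 2w^2 - w$. *)
Definition pw y := (pq y)^-1.
Definition pphi y := y / pq y.
Definition dpphi y := 2 * pw y ^+ 2 - pw y.

Lemma pq_ge1 y : 1 <= pq y.
Proof. by rewrite lerDl sqr_ge0. Qed.

Lemma pq_gt0 y : 0 < pq y.
Proof. exact: lt_le_trans ltr01 (pq_ge1 y). Qed.

Lemma pq_neq0 y : pq y != 0.
Proof. by rewrite gt_eqF// pq_gt0. Qed.

Lemma pw_gt0 y : 0 < pw y.
Proof. by rewrite invr_gt0 pq_gt0. Qed.

Lemma pw_le1 y : pw y <= 1.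
Proof. by rewrite invf_le1 ?pq_gt0// pq_ge1. Qed.

Lemma pphi_sqr y : pphi y ^+ 2 = pw y - pw y ^+ 2.
Proof.
by rewrite /pphi /pw; have := pq_neq0 y; rewrite /pq => q0; field.
Qed.

Lemma pphiM y : y * pphi y = 1 - pw y.
Proof. by rewrite /pphi /pw; have := pq_neq0 y; rewrite /pq => q0; field. Qed.

Lemma normr_pphi y : `|pphi y| <= 1.
Proof.
rewrite -(@ler_pXn2r _ 2) ?nnegrE// expr1n -normrX ger0_norm ?sqr_ge0// pphi_sqr.
by have := pw_le1 y; have := sqr_ge0 (pw y); lra.
Qed.

Lemma normr_dpphi y : `|dpphi y| <= 1.
Proof.
have w1 := pw_le1 y; have w0 := pw_gt0 y.
have : pw y ^+ 2 <= pw y by rewrite expr2 ler_piMl// ltW.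
by have := sqr_ge0 (pw y); rewrite ler_norml /dpphi => *; apply/andP; lra.
Qed.

Lemma continuous_pq : continuous (pq : R -> R).
Proof.
move=> y; apply: cvgD; first exact: cvg_cst.
exact: exprn_continuous.
Qed.

Lemma continuous_pw : continuous (pw : R -> R).
Proof. by move=> y; apply: cvgV; [exact: pq_neq0|exact: continuous_pq]. Qed.

Lemma continuous_pphi : continuous (pphi : R -> R).
Proof. by move=> y; apply: cvgM; [exact: cvg_id|exact: continuous_pw]. Qed.

Lemma continuous_dpphi : continuous (dpphi : R -> R).
Proof.
move=> y; apply: cvgB; last exact: continuous_pw.
apply: cvgM; first exact: cvg_cst.
apply: (@cvg_comp _ _ _ pw (fun z => z ^+ 2) _ (nbhs (pw y))).
  exact: continuous_pw.
exact: exprn_continuous.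
Qed.

Lemma is_derive_pq y : is_derive y 1 (pq : R -> R) (2 * y).
Proof.
pose p : {poly R} := 1%:P + 'X^2.
have -> : (pq : R -> R) = (fun y => p.[y]).
  by apply/funext => z; rewrite /p hornerD hornerC hornerXn.
apply: is_derive_eq (is_derive1_horner p y) _.
by rewrite /p derivD derivC derivXn add0r hornerMn hornerXn expr1 mulr_natl.
Qed.

Lemma is_derive_pw y : is_derive y 1 (pw : R -> R) (- 2 * y * pw y ^+ 2).
Proof.
have h := is_deriveV (pq_neq0 y) (is_derive_pq y).
by apply: is_derive_eq h _; rewrite /pw /GRing.scale/=; have := pq_neq0 y => q0; field.
Qed.

Lemma is_derive_pphi y : is_derive y 1 (pphi : R -> R) (dpphi y).
Proof.
apply: is_derive_eq (is_derive1_mul (is_derive_id y 1) (is_derive_pw y)) _.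
rewrite /dpphi /pw; have := pq_neq0 y; rewrite /pq => q0.
by field.
Qed.

Lemma is_derive_powR_pq m y :
  is_derive y 1 (fun z => pq z `^ (- m)) (- 2 * m * pphi y * pq y `^ (- m)).
Proof.
have h : is_derive y 1 ((@powR R ^~ (- m)) \o pq)
    (- m * pq y `^ (- m - 1) * (2 * y)).
  by apply: is_derive1_comp; [exact/is_derive1_powR/pq_gt0|exact: is_derive_pq].
apply: is_derive_eq h _; rewrite powRB ?pq_neq0 ?implybT// powRr1 ?(ltW (pq_gt0 y))//.
by rewrite /pphi; field; exact: pq_neq0.
Qed.

Lemma continuous_powR_pq m : continuous (fun z => pq z `^ (- m)).
Proof. exact: is_derive1_continuous (is_derive_powR_pq m). Qed.

(** With $u = y - t$ the difference of the two sides is $1 + (t - u)^2 + 2t^2u^2$. The inequality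
    bounds [log_ratio t] uniformly in [y], and for large [t] pushes it close to its upper bound when
    [y] stays in a fixed interval. *)
Lemma peetre y t : pq y <= 2 * pq t * pq (y - t).
Proof.
rewrite /pq.
have : 0 <= (1 + t * (y - t)) ^+ 2 by exact: sqr_ge0.
have : 0 <= (t - (y - t)) ^+ 2 by exact: sqr_ge0.
have : 0 <= t ^+ 2 * (y - t) ^+ 2 by rewrite mulr_ge0 ?sqr_ge0.
by nra.
Qed.

(** Linear growth of [r] is dominated by $2q^{1/2}$, with $q$ standing for [pq], so the product is
    at most $2q^{1/2-m}$: this is where $m > 1/2$ removes the boundary terms. The shift [a] allows
    for the location. *)
Lemma cvg_powR_pq_decay m (r : R -> R) (y : nat -> R) (a : R) : 2^-1 < m ->
  (forall z, `|r z| <= 1 + `|z|) -> (forall n, n%:R - a <= `|y n|) ->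
  r (y n) * pq (y n) `^ (- m) @[n --> \oo] --> 0.
Proof.
move=> hm hr hy; apply/cvgr0Pnorm_le => e e0.
have m0 : 0 < m - 2^-1 by rewrite subr_gt0.
(* The solution of $2\exp(-(m - 1/2)M) = e$. *)
pose M := - ln (e / 2) / (m - 2^-1).
near=> n.
have n1 : expR M + a + 1 <= n%:R by near: n; exact: nbhs_infty_ger.
have y1 : expR M + 1 <= `|y n| by have := hy n; lra.
have M0 := expR_gt0 M.
have yq : `|y n| <= pq (y n).
  rewrite /pq -real_normK ?num_real//.
  by have := sqr_ge0 (`|y n| - 1); nra.
have lnM : M <= ln (pq (y n)).
  by rewrite -[leLHS]expRK ler_ln ?posrE ?expR_gt0 ?pq_gt0//; lra.
have rq : `|r (y n)| <= 2 * pq (y n) `^ 2^-1.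
  rewrite (le_trans (hr _))// powR12_sqrt ?(ltW (pq_gt0 _))//.
  rewrite -(@ler_pXn2r _ 2) ?nnegrE ?addr_ge0 ?mulr_ge0 ?sqrtr_ge0//.
  rewrite exprMn sqr_sqrtr ?(ltW (pq_gt0 _))// /pq -[y n ^+ 2]real_normK ?num_real//.
  by have := sqr_ge0 (`|y n| - 1); nra.
rewrite normrM [X in _ * X]ger0_norm ?powR_ge0//.
apply: (@le_trans _ _ (2 * pq (y n) `^ 2^-1 * pq (y n) `^ (- m))).
  by rewrite ler_wpM2r ?powR_ge0.
rewrite !powR_expR ?pq_gt0// -mulrA -expRD -ler_pdivlMl//.
rewrite -[leRHS]lnK ?posrE ?mulr_gt0 ?invr_gt0// ler_expR [2^-1 * e]mulrC.
have := ler_wpM2l (ltW m0) lnM; rewrite /M [_ * (_ / _)]mulrC divfK ?gt_eqF//.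
by rewrite mulrBl mulNr; lra.
Unshelve. all: by end_near. Qed.

End pearson_functions.

(** * The density, its normalization and the Stein identity *)

Section pearson_law.
Context (R : realType) (m theta : R).
Hypothesis hm : 2^-1 < m.
Local Notation mu := (@lebesgue_measure R).
Local Notation p := (fun x : R => pvii_density m (x - theta)).
Hypothesis p_total : (\int[mu]_x (pvii_density m (x - theta))%:E = 1)%E.

Lemma pvii_densityE x : pvii_density m x = pvii_const m * pq x `^ (- m).
Proof. by []. Qed.

(** By the conventions for [fine] and the inverse, a divergent normalizing integral would give the
    constant 0; the density would then vanish, against total mass one. No integrability of the
    kernel has to be computed. *)
Lemma pvii_const_gt0 : 0 < pvii_const m.
Proof.
rewrite lt_neqAle invr_ge0 fine_ge0 ?andbT; last first.
  by apply: integral_ge0 => x _; rewrite lee_fin powR_ge0.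
apply/eqP => c0; move: p_total.
under eq_integral do rewrite pvii_densityE -c0 mul0r.
by rewrite integral0 => /eqP; rewrite lt_eqF// lte01.
Qed.

Lemma continuous_shift_comp (f : R -> R) (a : R) :
  continuous f -> continuous (fun x => f (x - a)).
Proof.
move=> cf x; apply: (@cvg_comp _ _ _ (fun x => x - a) f _ (nbhs (x - a))).
  by apply: cvgB; [exact: cvg_id|exact: cvg_cst].
exact: cf.
Qed.

Lemma is_derive_shift_comp (f : R -> R) (a df x : R) :
  is_derive (x - a) 1 f df -> is_derive x 1 (fun x => f (x - a)) df.
Proof.
move=> hf; have h : is_derive x 1 (f \o (fun x => x - a)) (df * 1).
  apply: is_derive1_comp => //.
  have hs := is_deriveB (is_derive_id x 1) (is_derive_cst a x 1).
  by apply: is_derive_eq hs _; rewrite subr0.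
by apply: is_derive_eq h _; rewrite mulr1.
Qed.

Lemma pvii_density_ge0 x : 0 <= pvii_density m x.
Proof. by rewrite pvii_densityE mulr_ge0 ?powR_ge0// ltW// pvii_const_gt0. Qed.

Lemma continuous_pvii_density : continuous (pvii_density m).
Proof.
move=> x; apply: cvgM; first exact: cvg_cst.
exact: continuous_powR_pq.
Qed.

Lemma integrable_pvii_density : mu.-integrable setT (EFin \o p).
Proof.
apply/integrableP; split.
  apply/measurable_EFinP; apply: continuous_measurable_fun.
  exact: continuous_shift_comp continuous_pvii_density.
under eq_integral do rewrite /= ger0_norm ?pvii_density_ge0//.
by rewrite p_total ltry.
Qed.

Lemma integrable_bounded_pvii (h : R -> R) (K : R) : measurable_fun setT h ->
  (forall x, `|h x| <= K) -> mu.-integrable setT (EFin \o (fun x : R => h x * p x)).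
Proof.
move=> mh hK; have mp : measurable_fun setT p.
  apply: continuous_measurable_fun.
  exact: continuous_shift_comp continuous_pvii_density.
apply: (@le_integrable _ _ _ mu setT measurableT _ (EFin \o (fun x : R => K * p x))).
- by apply/measurable_EFinP; exact: measurable_funM.
- move=> x _ /=; rewrite lee_fin [leLHS]normrM [leRHS]normrM.
  rewrite [`|pvii_density _ _|]ger0_norm ?pvii_density_ge0//.
  by rewrite ler_wpM2r ?pvii_density_ge0// (le_trans (hK x))// ler_norm.
- exact: (integrableZl measurableT K integrable_pvii_density).
Qed.

(* Stein identity of the density [pq `^ (- m)], whose logarithmic derivative is
   [- 2 m pphi]. *)
Lemma pvii_stein (r dr : R -> R) (K : R) :
  (forall y : R, is_derive y 1 r (dr y)) -> continuous dr ->
  (forall y, `|r y| <= 1 + `|y|) ->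
  (forall y, `|dr y - 2 * m * pphi y * r y| <= K) ->
  \int[mu]_x ((dr (x - theta) - 2 * m * pphi (x - theta) * r (x - theta)) * p x) = 0.
Proof.
move=> hr cdr r_le hK.
pose h y := dr y - 2 * m * pphi y * r y.
have cr := is_derive1_continuous hr.
have ch : continuous h.
  move=> y; apply: cvgB; first exact: cdr.
  apply: cvgM; last exact: cr.
  by apply: cvgM; [exact: cvg_cst|exact: continuous_pphi].
pose G y := pvii_const m * (r y * pq y `^ (- m)).
have dG (y : R) : is_derive y 1 G (h y * pvii_density m y).
  have hG := is_derive1_mul (is_derive_cst (pvii_const m) y 1)
    (is_derive1_mul (hr y) (is_derive_powR_pq m y)).
  by apply: is_derive_eq hG _; rewrite pvii_densityE /h /=; ring.
have dF (x : R) : is_derive x 1 (fun x => G (x - theta)) (h (x - theta) * p x).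
  exact: is_derive_shift_comp.
have cf : continuous (fun x : R => h (x - theta) * p x).
  move=> x; apply: cvgM.
    exact: (continuous_shift_comp ch).
  exact: (continuous_shift_comp continuous_pvii_density).
have intf : mu.-integrable setT (EFin \o (fun x : R => h (x - theta) * p x)).
  apply: (@integrable_bounded_pvii _ K) => [|x]; last exact: hK.
  by apply: continuous_measurable_fun; exact: continuous_shift_comp.
have G0 (y : nat -> R) : (forall n, n%:R - `|theta| <= `|y n|) ->
    G (y n) @[n --> \oo] --> 0.
  move=> hy; rewrite -[X in _ --> X](mulr0 (pvii_const m)).
  apply: cvgM; first exact: cvg_cst.
  exact: cvg_powR_pq_decay hy.
rewrite /Rintegral (integral_derive_vanishing dF cf intf)//.
  apply: (G0 (fun n => n.+1%:R - theta)) => n.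
  have := ler_normB (n.+1%:R - theta) (- theta).
  rewrite opprK subrK normrN ger0_norm// => h1.
  have : n%:R <= n.+1%:R :> R by rewrite ler_nat.
  by move: h1; lra.
apply: (G0 (fun n => - n.+1%:R - theta)) => n.
have := ler_normB (- n.+1%:R - theta) (- theta).
rewrite opprK subrK !normrN ger0_norm// => h1.
have : n%:R <= n.+1%:R :> R by rewrite ler_nat.
by move: h1; lra.
Qed.

End pearson_law.

Lemma ge0_integral_shift (R : realType) (G : R -> R) (t : R) :
  continuous G -> (forall x, 0 <= G x) ->
  (\int[@lebesgue_measure R]_x (G x)%:E = \int[@lebesgue_measure R]_x (G (x + t))%:E)%E.
Proof.
move=> cG G0; pose F x : R := x + t.
have dF (x : R) : is_derive x 1 F 1.
  have hs := is_deriveD (is_derive_id x 1) (is_derive_cst t x 1).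
  by apply: is_derive_eq hs _; rewrite addr0.
have F'E : F^`()%classic = cst 1 by apply/funext => x; rewrite derive1E derive_val.
rewrite (@increasing_ge0_integration_by_substitutionT _ F G)//.
- by apply: eq_integral => x _; rewrite F'E fctE/= mulr1.
- by move=> x y xy; rewrite ltrD2r.
- by rewrite F'E => ?; exact: cvg_cst.
- by rewrite F'E; exact: is_cvg_cst.
- by rewrite F'E; exact: is_cvg_cst.
- exact: cvg_addrr_Ny.
- exact: cvg_addrr.
Qed.

(** * Moments of the score and of its derivative *)

Section pearson_moments.
Context (R : realType) (m theta : R).
Hypothesis hm : 2^-1 < m.
Local Notation mu := (@lebesgue_measure R).
Local Notation p := (fun x : R => pvii_density m (x - theta)).
Hypothesis p_total : (\int[mu]_x (pvii_density m (x - theta))%:E = 1)%E.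

Let m0 : 0 < m. Proof. by apply: lt_trans hm; rewrite invr_gt0. Qed.

Definition pvii_mean (h : R -> R) : R := \int[mu]_x (h (x - theta) * p x).

Lemma integrable_pvii_mean (h : R -> R) (K : R) : measurable_fun setT h ->
  (forall x, `|h x| <= K) ->
  mu.-integrable setT (EFin \o (fun x : R => h (x - theta) * p x)).
Proof.
move=> mh hK; apply: (@integrable_bounded_pvii _ m theta p_total _ K) => [|x].
  by apply: measurableT_comp => //; exact: measurable_funB.
exact: hK.
Qed.

Lemma pvii_mean1 : pvii_mean (fun=> 1) = 1.
Proof.
by rewrite /pvii_mean /Rintegral; under eq_integral do rewrite mul1r; rewrite p_total.
Qed.

Lemma pvii_mean_lin (f g : R -> R) (Kf Kg a b : R) :
  measurable_fun setT f -> measurable_fun setT g ->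
  (forall x, `|f x| <= Kf) -> (forall x, `|g x| <= Kg) ->
  pvii_mean (fun y => a * f y + b * g y) = a * pvii_mean f + b * pvii_mean g.
Proof.
move=> mf mg hf hg.
have If := integrable_pvii_mean mf hf.
have Ig := integrable_pvii_mean mg hg.
rewrite /pvii_mean -!RintegralZl// -RintegralD//.
- by apply: eq_Rintegral => x _; ring.
- exact: (integrableZl measurableT a If).
- exact: (integrableZl measurableT b Ig).
Qed.

Lemma eq_pvii_mean (f g : R -> R) : f =1 g -> pvii_mean f = pvii_mean g.
Proof. by move=> fg; apply: eq_Rintegral => x _; rewrite fg. Qed.

Let mw : measurable_fun setT (@pw R).
Proof. exact: continuous_measurable_fun (@continuous_pw R). Qed.

Let mphi : measurable_fun setT (@pphi R).
Proof. exact: continuous_measurable_fun (@continuous_pphi R). Qed.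

Let w_bound (y : R) : `|pw y| <= 1.
Proof. by rewrite ger0_norm ?pw_le1// ltW// pw_gt0. Qed.

Let mw2 : measurable_fun setT (fun y : R => pw y ^+ 2).
Proof. exact: measurable_funX. Qed.

Let w2_bound (y : R) : `|pw y ^+ 2| <= 1.
Proof. by rewrite normrX exprn_ile1. Qed.

Lemma pvii_mean_pphi : pvii_mean (@pphi R) = 0.
Proof.
have H : pvii_mean (fun y => 0 - 2 * m * pphi y * 1) = 0.
  apply: (@pvii_stein _ _ _ hm p_total (fun=> 1) (fun=> 0) (2 * m)) => //.
  - by move=> y; exact: cvg_cst.
  - by move=> y; rewrite normr1 lerDl.
  - move=> y; rewrite sub0r mulr1 normrN normrM ger0_norm ?mulr_ge0 ?(ltW m0)//.
    by rewrite ler_piMr ?normr_pphi// mulr_ge0 ?(ltW m0).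
move: H; rewrite (@eq_pvii_mean _ (fun y => (- 2 * m) * pphi y + 0 * pphi y)).
  rewrite (pvii_mean_lin _ _ mphi mphi (@normr_pphi R) (@normr_pphi R)).
  move/eqP; rewrite mul0r addr0 mulf_eq0 mulf_eq0 oppr_eq0 pnatr_eq0/= gt_eqF//=.
  by move/eqP.
by move=> y; ring.
Qed.

(** Stein's identity with $r = y$: the integrand $1 - 2m(1 - w)$ is bounded although $r$ is not. *)
Lemma pvii_mean_pw : pvii_mean (@pw R) = (2 * m - 1) / (2 * m).
Proof.
have K y : `|1 - 2 * m * pphi y * y| <= 1 + 2 * m.
  rewrite -mulrA [pphi y * y]mulrC pphiM (le_trans (ler_normB _ _))// normr1 lerD2l.
  rewrite normrM ger0_norm ?mulr_ge0 ?(ltW m0)// ler_piMr ?mulr_ge0 ?(ltW m0)//.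
  have := pw_gt0 y; have := pw_le1 y => w1 w0.
  by rewrite ger0_norm; lra.
have H : pvii_mean (fun y => 1 - 2 * m * pphi y * y) = 0.
  apply: (@pvii_stein _ _ _ hm p_total id (fun=> 1) (1 + 2 * m)) => //.
  - by move=> y; exact: cvg_cst.
  - by move=> y; rewrite lerDr.
have k1 (y : R) : `|(fun _ : R => 1 : R) y| <= 1 by rewrite normr1.
have mk1 : measurable_fun setT (fun _ : R => 1 : R) by exact: measurable_cst.
move: H; rewrite (@eq_pvii_mean _ (fun y => (1 - 2 * m) * 1 + (2 * m) * pw y)).
  rewrite (pvii_mean_lin _ _ mk1 mw k1 w_bound) pvii_mean1 => H.
  have m20 : 2 * m != 0 by rewrite mulf_neq0// gt_eqF.
  clear k1 mk1 K.
  by apply: (mulfI m20); rewrite [RHS]mulrC divfK//; lra.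
by move=> y; rewrite -mulrA [pphi y * y]mulrC pphiM; ring.
Qed.

(** Stein's identity with $r = \phi$, whose integrand is $(2 + 2m)w^2 - (1 + 2m)w$. *)
Lemma pvii_mean_pw2 :
  (2 + 2 * m) * pvii_mean (fun y => pw y ^+ 2) = (1 + 2 * m) * pvii_mean (@pw R).
Proof.
have K (y : R) : `|dpphi y - 2 * m * pphi y * pphi y| <= 1 + 2 * m.
  rewrite (le_trans (ler_normB _ _))// lerD ?normr_dpphi//.
  rewrite -mulrA normrM ger0_norm ?mulr_ge0 ?(ltW m0)// ler_piMr ?mulr_ge0 ?(ltW m0)//.
  by rewrite normrM mulr_ile1 ?normr_pphi.
have H : pvii_mean (fun y => dpphi y - 2 * m * pphi y * pphi y) = 0.
  apply: (@pvii_stein _ _ _ hm p_total (@pphi R) (@dpphi R) (1 + 2 * m)) => //.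
  - exact: is_derive_pphi.
  - exact: continuous_dpphi.
  - by move=> y; rewrite (le_trans (normr_pphi _))// lerDl.
move: H; rewrite (@eq_pvii_mean _
    (fun y => (2 + 2 * m) * pw y ^+ 2 + - (1 + 2 * m) * pw y)).
  by rewrite (pvii_mean_lin _ _ mw2 mw w2_bound w_bound); lra.
by move=> y; rewrite -mulrA -expr2 pphi_sqr /dpphi; ring.
Qed.

Lemma pvii_mean_pphi2 :
  pvii_mean (fun y => pphi y ^+ 2) = (2 * m - 1) / (4 * m * (m + 1)).
Proof.
rewrite (@eq_pvii_mean _ (fun y => 1 * pw y + - 1 * pw y ^+ 2)); last first.
  by move=> y; rewrite pphi_sqr; ring.
rewrite (pvii_mean_lin _ _ mw mw2 w_bound w2_bound).
have m1 : m + 1 != 0 by rewrite gt_eqF// ltr_wpDl// ltW.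
have mn0 : m != 0 by rewrite gt_eqF.
have -> : pvii_mean (fun y => pw y ^+ 2) = (1 + 2 * m) / (2 + 2 * m) * pvii_mean (@pw R).
  have h : 2 + 2 * m != 0 by rewrite gt_eqF// ltr_wpDl// mulr_gt0.
  by apply: (mulfI h); rewrite pvii_mean_pw2; field.
rewrite pvii_mean_pw; field; rewrite mn0 m1 /=.
by rewrite gt_eqF// ltr_wpDl// mulr_gt0.
Qed.

(** The information identity: the variance of the score $2m\phi$ equals its mean slope. *)
Lemma pvii_mean_dpphi :
  pvii_mean (@dpphi R) = 2 * m * pvii_mean (fun y => pphi y ^+ 2).
Proof.
rewrite (@eq_pvii_mean (fun y => pphi y ^+ 2) (fun y => 1 * pw y + - 1 * pw y ^+ 2)); last first.
  by move=> y; rewrite pphi_sqr; ring.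
rewrite (@eq_pvii_mean (@dpphi R) (fun y => - 1 * pw y + 2 * pw y ^+ 2)); last first.
  by move=> y; rewrite /dpphi; ring.
rewrite !(pvii_mean_lin _ _ mw mw2 w_bound w2_bound).
by have := pvii_mean_pw2; lra.
Qed.

End pearson_moments.

(** * Log-likelihood ratios and their positive mean *)

Section pearson_divergence.
Context (R : realType) (m theta : R).
Hypothesis hm : 2^-1 < m.
Local Notation mu := (@lebesgue_measure R).
Local Notation p := (fun x : R => pvii_density m (x - theta)).
Hypothesis p_total : (\int[mu]_x (pvii_density m (x - theta))%:E = 1)%E.

Let m0 : 0 < m. Proof. by apply: lt_trans hm; rewrite invr_gt0. Qed.

(** [m * log_ratio t y] is the logarithm of $f(y)/f(y - t)$, so maximizing the likelihood is
    minimizing its sum over the observations. Subtracting [ln (pq y)] makes each term bounded in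
    [y]. *)
Definition log_ratio (t y : R) : R := ln (pq (y - t)) - ln (pq y).

Lemma continuous_log_ratio t : continuous (log_ratio t).
Proof.
have cl : continuous (fun y : R => ln (pq y)).
  move=> y; apply: (@cvg_comp _ _ _ (@pq R) (@ln R) _ (nbhs (pq y))).
    exact: continuous_pq.
  exact/continuous_ln/pq_gt0.
move=> y; apply: cvgB; last exact: cl.
exact: (continuous_shift_comp cl).
Qed.

Lemma normr_log_ratio t y : `|log_ratio t y| <= ln (2 * pq t).
Proof.
rewrite ler_norml /log_ratio; apply/andP; split.
  rewrite lerBrDl lerBlDr -lnM ?posrE ?mulr_gt0 ?pq_gt0//.
  by rewrite ler_ln ?posrE ?mulr_gt0 ?pq_gt0// mulrC peetre.
rewrite lerBlDr -lnM ?posrE ?mulr_gt0 ?pq_gt0//.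
rewrite ler_ln ?posrE ?mulr_gt0 ?pq_gt0//.
have := peetre (y - t) (- t); rewrite opprK subrK.
by rewrite /pq sqrrN.
Qed.

(* Positivity of the Kullback-Leibler divergence: with
   [s = sqrt (f (y - t) / f y)], [m * log_ratio = - 2 ln s >= (1 - s^2) + (1 - s)^2]
   and [s^2] has mean one. *)
Lemma pvii_mean_log_ratio_gt0 t : t != 0 -> 0 < pvii_mean m theta (log_ratio t).
Proof.
move=> t0.
pose s y := expR (- (m / 2) * log_ratio t y).
have cs : continuous s.
  move=> y; apply: (@cvg_comp _ _ _ (fun y => - (m / 2) * log_ratio t y) (@expR R) _
    (nbhs (- (m / 2) * log_ratio t y))).
    by apply: cvgM; [exact: cvg_cst|exact: continuous_log_ratio].
  exact: continuous_expR.
have s0 y : 0 <= s y by exact: expR_ge0.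
pose K := expR (m / 2 * ln (2 * pq t)).
have sK y : s y <= K.
  rewrite ler_expR (le_trans (ler_norm _))// normrM normrN.
  by rewrite [`|m / 2|]ger0_norm ?divr_ge0 ?(ltW m0)// ler_wpM2l ?divr_ge0 ?(ltW m0)// normr_log_ratio.
have K0 : 0 <= K by exact: expR_ge0.
have ms : measurable_fun setT s by exact: continuous_measurable_fun.
have ms2 : measurable_fun setT (fun y => s y ^+ 2) by exact: measurable_funX.
have s2K y : `|s y ^+ 2| <= K ^+ 2.
  by rewrite ger0_norm ?sqr_ge0// lerXn2r ?nnegrE.
have m1 : measurable_fun setT (fun _ : R => 1 : R) by exact: measurable_cst.
have b1 (y : R) : `|(fun _ : R => 1 : R) y| <= 1 by rewrite normr1.
have m1s : measurable_fun setT (fun y => (1 - s y) ^+ 2).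
  by apply: measurable_funX; exact: measurable_funB.
have b1s y : `|(1 - s y) ^+ 2| <= (1 + K) ^+ 2.
  rewrite normrX lerXn2r ?nnegrE ?addr_ge0// (le_trans (ler_normB _ _))//.
  by rewrite normr1 lerD2l ger0_norm.
have mL : measurable_fun setT (log_ratio t).
  exact: continuous_measurable_fun (@continuous_log_ratio t).
(* $s(y)^2 f(y) = f(y - t)$, so the integral is the total mass of a translate. *)
have s2E : pvii_mean m theta (fun y => s y ^+ 2) = 1.
  rewrite /pvii_mean /Rintegral.
  have -> : (\int[mu]_x (s (x - theta) ^+ 2 * pvii_density m (x - theta))%:E =
      \int[mu]_x (pvii_density m (x - theta - t))%:E)%E.
    apply: eq_integral => x _; congr (_%:E).
    rewrite !pvii_densityE mulrCA; congr (_ * _).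
    rewrite !powR_expR ?pq_gt0// /s expr2 -!expRD; congr expR.
    by rewrite /log_ratio; field.
  rewrite (@ge0_integral_shift _ (fun x => pvii_density m (x - theta - t)) t).
  - under eq_integral => x _.
      rewrite (_ : x + t - theta - t = x - theta); last by ring.
      over.
    by rewrite p_total.
  - apply: (@continuous_shift_comp _ (fun y => pvii_density m (y - t)) theta).
    exact: (continuous_shift_comp (@continuous_pvii_density _ m)).
  - by move=> x; exact: (pvii_density_ge0 p_total).
have D0 : 0 < pvii_mean m theta (fun y => (1 - s y) ^+ 2).
  rewrite lt_neqAle; apply/andP; split; last first.
    by apply: Rintegral_ge0 => x _; rewrite mulr_ge0 ?sqr_ge0 ?(pvii_density_ge0 p_total).
  apply/eqP => /esym D.
  have I := integrable_pvii_mean p_total m1s b1s.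
  have De : (\int[mu]_x `|((1 - s (x - theta)) ^+ 2 * p x)%:E| = 0)%E.
    transitivity (\int[mu]_x ((1 - s (x - theta)) ^+ 2 * p x)%:E)%E.
      apply: eq_integral => x _; rewrite gee0_abs// lee_fin.
      by rewrite mulr_ge0 ?sqr_ge0 ?(pvii_density_ge0 p_total).
    by rewrite -[LHS]fineK ?integrable_fin_num//; congr (_%:E).
  have mI : measurable_fun setT
      (fun x : R => ((1 - s (x - theta)) ^+ 2 * p x)%:E) by exact: measurable_int I.
  have ae1 := (ae_eq_integral_abs mu measurableT mI).1 De.
  (* [s] equals 1 only where $y^2 = (y - t)^2$, that is at $y = t/2$. A vanishing integral would
     make the density zero at almost every other point. *)
  pose x0 := theta + t / 2.
  have ae2 : {ae mu, forall x : R, x <> x0}.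
    exists [set x0]; split => //; first exact: lebesgue_measure_set1.
    by move=> x /= /contrapT.
  have ae3 : ae_eq mu setT (EFin \o p) (cst 0%E).
    move: ae1 ae2; apply: filterS2 => x + xx0 _ => /(_ Logic.I) /= [] /eqP.
    rewrite mulf_eq0 => /orP[|/eqP -> //]; rewrite sqrf_eq0 subr_eq0 => /eqP h.
    have {h} : log_ratio t (x - theta) = 0.
      have : expR 0 = s (x - theta) by rewrite expR0.
      move=> /expR_inj/eqP; rewrite eq_sym mulf_eq0 oppr_eq0 => /orP[|/eqP//].
      by rewrite gt_eqF// divr_gt0.
    rewrite /log_ratio => /eqP; rewrite subr_eq0 => /eqP /ln_inj.
    rewrite !posrE !pq_gt0 => /(_ isT isT) /addrI /eqP.
    rewrite eqf_sqr => /orP[/eqP h|/eqP h].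
      by exfalso; move/eqP: t0; apply; clear b1; lra.
    by exfalso; apply: xx0; rewrite /x0; clear b1; lra.
  have : (\int[mu]_x (p x)%:E = \int[mu]_x 0)%E.
    apply: ae_eq_integral => //.
    exact: measurable_int (integrable_pvii_density p_total).
  by rewrite integral0 p_total => /eqP; rewrite gt_eqF// lte01.
have le1 : pvii_mean m theta (fun y => 1 * 1 + - 1 * s y ^+ 2) = 0.
  by rewrite (pvii_mean_lin p_total _ _ m1 ms2 b1 s2K) s2E (pvii_mean1 p_total); ring.
have m1s2 : measurable_fun setT (fun y => 1 * 1 + - 1 * s y ^+ 2).
  by apply: measurable_funD => //; exact: measurable_funM.
have b1s2 y : `|1 * 1 + - 1 * s y ^+ 2| <= 1 + K ^+ 2.
  rewrite mul1r mulN1r (le_trans (ler_normB _ _))// normr1 lerD2l.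
  exact: s2K.
have Lb := normr_log_ratio t.
have lin := pvii_mean_lin p_total 1 1 m1s2 m1s b1s2 b1s.
have linL := pvii_mean_lin p_total m 0 mL mL Lb Lb.
pose f1 y := 1 * (1 * 1 + - 1 * s y ^+ 2) + 1 * (1 - s y) ^+ 2.
pose f2 y := m * log_ratio t y + 0 * log_ratio t y.
have mf1 : measurable_fun setT f1.
  by apply: measurable_funD; exact: measurable_funM.
have mf2 : measurable_fun setT f2.
  by apply: measurable_funD; exact: measurable_funM.
have bf1 y : `|f1 y| <= 1 + K ^+ 2 + (1 + K) ^+ 2.
  rewrite /f1 mul1r [1 * (1 - _) ^+ 2]mul1r (le_trans (ler_normD _ _))// lerD//.
have bf2 y : `|f2 y| <= m * ln (2 * pq t).
  rewrite /f2 mul0r addr0 normrM ger0_norm ?(ltW m0)//.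
  by rewrite ler_wpM2l ?(ltW m0).
have : pvii_mean m theta f1 <= pvii_mean m theta f2.
  apply: le_Rintegral => //.
  - exact: (integrable_pvii_mean p_total mf1 bf1).
  - exact: (integrable_pvii_mean p_total mf2 bf2).
  move=> x _; rewrite ler_wpM2r ?(pvii_density_ge0 p_total)// /f1 /f2.
  (* [f1] equals $2(1 - s)$, and $s \ge 1 - (m/2)\,$[log_ratio]. *)
  have := expR_ge1Dx (- (m / 2) * log_ratio t (x - theta)).
  by rewrite -/(s (x - theta)); set S := s _; set L := log_ratio _ _; clear b1; nra.
rewrite lin linL le1 mulr0 add0r mul1r mul0r addr0 => h.
by rewrite -(pmulr_rgt0 _ m0) (lt_le_trans D0).
Qed.

End pearson_divergence.

(** * Consistency and the score equation *)

Section pearson_likelihood.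
Context (R : realType).
Implicit Types (m t y z h : R).

(** The ratio of the two kernels is exactly $1 + (-2h\phi + h^2w)$, and $\ln(1 + x) \le x$. Being
    global, this majorant yields both the Lipschitz estimate and the score equation. *)
Lemma ln_pq_quadratic z h :
  ln (pq (z - h)) - ln (pq z) <= - 2 * h * pphi z + h ^+ 2.
Proof.
rewrite -ln_div ?posrE ?pq_gt0//.
have -> : pq (z - h) / pq z = 1 + (- 2 * h * pphi z + h ^+ 2 * pw z).
  by rewrite /pphi /pw; have := pq_neq0 z; rewrite /pq => q0; field.
have b : h ^+ 2 * pw z <= h ^+ 2 by rewrite ler_piMr ?sqr_ge0 ?pw_le1.
apply: le_trans (le_ln1Dx _) _; last by rewrite lerD2l.
have : 0 < pq (z - h) / pq z by rewrite divr_gt0 ?pq_gt0.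
have -> : pq (z - h) / pq z = 1 + (- 2 * h * pphi z + h ^+ 2 * pw z).
  by rewrite /pphi /pw; have := pq_neq0 z; rewrite /pq => q0; field.
by lra.
Qed.

Lemma log_ratio_lipschitz s t y :
  log_ratio s y - log_ratio t y <= 2 * `|s - t| + (s - t) ^+ 2.
Proof.
have := ln_pq_quadratic (y - t) (s - t).
rewrite (_ : y - t - (s - t) = y - s); last by ring.
rewrite /log_ratio => H.
have : - 2 * (s - t) * pphi (y - t) <= 2 * `|s - t|.
  rewrite (le_trans (ler_norm _))// normrM.
  rewrite [`|- 2 * _|]normrM normrN (ger0_norm (ler0n R 2)).
  by rewrite ler_piMr ?normr_pphi// mulr_ge0.
by lra.
Qed.

(** The remainder is exactly $-h^2$ times a combination of three products, each at most 1 in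
    absolute value; hence the constant 3, uniform in [z]. *)
Lemma pphi_taylor z h : `|pphi (z - h) - pphi z + h * dpphi z| <= 3 * h ^+ 2.
Proof.
have q0 := pq_neq0 z; have q1 := pq_neq0 (z - h).
have -> : pphi (z - h) - pphi z + h * dpphi z =
    - h ^+ 2 * (2 * pphi z * (pw z * pw (z - h)) + pphi (z - h) * pw z ^+ 2
      - pphi (z - h) * (1 - pw z) * pw z).
  rewrite /dpphi /pphi /pw; move: q0 q1; rewrite /pq => q0 q1.
  by field; rewrite q0 q1.
rewrite normrM normrN [`|h ^+ 2|]ger0_norm ?sqr_ge0//
  [leRHS]mulrC ler_wpM2l ?sqr_ge0//.
have p1 := normr_pphi z; have p2 := normr_pphi (z - h).
have w1 := pw_gt0 z; have w2 := pw_le1 z.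
have w3 := pw_gt0 (z - h); have w4 := pw_le1 (z - h).
have nw1 : `|pw z| <= 1 by rewrite gtr0_norm.
have nw2 : `|pw (z - h)| <= 1 by rewrite gtr0_norm.
have a1 : `|2 * pphi z * (pw z * pw (z - h))| <= 1.
  have : `|2 * pphi z| <= 1.
    rewrite /pphi normrM normrM normfV [`|pq z|]gtr0_norm ?pq_gt0// ger0_norm//.
    rewrite mulrA ler_pdivrMr ?pq_gt0// mul1r /pq -[z ^+ 2]real_normK ?num_real//.
    by have := sqr_ge0 (`|z| - 1); nra.
  by move=> ?; rewrite normrM mulr_ile1// normrM mulr_ile1.
have a2 : `|pphi (z - h) * pw z ^+ 2| <= 1.
  by rewrite normrM mulr_ile1// normrX exprn_ile1.
have a3 : `|pphi (z - h) * (1 - pw z) * pw z| <= 1.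
  rewrite normrM mulr_ile1// normrM mulr_ile1//.
  by rewrite ger0_norm; lra.
by rewrite (le_trans (ler_normB _ _))// (le_trans (lerD (ler_normD _ _) (lexx _)))//; lra.
Qed.

(** Comparing [tau] with [tau + h] through the quadratic majorant gives $2hS \le nh^2$ for every
    $h$, which forces $S = 0$ without differentiating the sum. *)
Lemma minimizer_score (y : nat -> R) n tau :
  (forall t, \sum_(i < n) ln (pq (y i - tau)) <= \sum_(i < n) ln (pq (y i - t))) ->
  \sum_(i < n) pphi (y i - tau) = 0.
Proof.
move=> hmin; set S := \sum_(i < n) _.
have key h : 2 * h * S <= n%:R * h ^+ 2.
  have : 0 <= \sum_(i < n) (- 2 * h * pphi (y i - tau) + h ^+ 2).
    apply: (@le_trans _ _ (\sum_(i < n) (ln (pq (y i - tau - h)) - ln (pq (y i - tau))))).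
      rewrite sumrB subr_ge0 (le_trans (hmin (tau + h)))//.
      by under eq_bigr do rewrite opprD addrA.
    by apply: ler_sum => i _; exact: ln_pq_quadratic.
  rewrite big_split/= -mulr_sumr sumr_const card_ord -/S mulr_natl.
  lra.
have n1 : 0 < n%:R + 1 :> R by rewrite ltr_wpDl.
(* This choice gives $2S^2/(n+1) \le S^2/(n+1)$; the denominator is nonzero even for $n = 0$. *)
have := key (S / (n%:R + 1)).
have -> : 2 * (S / (n%:R + 1)) * S = 2 * S ^+ 2 / (n%:R + 1) by field; rewrite gt_eqF.
have -> : n%:R * (S / (n%:R + 1)) ^+ 2 = (n%:R / (n%:R + 1)) * (S ^+ 2 / (n%:R + 1)).
  by field; rewrite gt_eqF.
move=> H; have S2 : 0 <= S ^+ 2 / (n%:R + 1) by rewrite divr_ge0 ?sqr_ge0// ltW.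
have : n%:R / (n%:R + 1) * (S ^+ 2 / (n%:R + 1)) <= 1 * (S ^+ 2 / (n%:R + 1)).
  by rewrite ler_wpM2r// ler_pdivrMr// mul1r lerDl.
move=> H2; have : S ^+ 2 / (n%:R + 1) <= 0 by lra.
rewrite ler_pdivrMr// mul0r => H3; apply/eqP; rewrite -sqrf_eq0.
by rewrite eq_le H3 sqr_ge0.
Qed.

(** Peetre's inequality with [t] and [y] exchanged. As [ln (2 * pq t)] also bounds [log_ratio t], an
    observation in a fixed interval contributes the largest possible value up to a constant. *)
Lemma log_ratio_tail t y A : 0 <= A -> `|y| <= A ->
  ln (2 * pq t) - (2 * ln 2 + 2 * ln (pq A)) <= log_ratio t y.
Proof.
move=> A0 yA; rewrite /log_ratio.
have hq : pq y <= pq A.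
  by rewrite /pq lerD2l -real_normK ?num_real// lerXn2r ?nnegrE.
have h1 : ln (pq y) <= ln (pq A) by rewrite ler_ln ?posrE ?pq_gt0.
have h2 : ln (pq t) <= ln (2 * pq y * pq (y - t)).
  rewrite ler_ln ?posrE ?mulr_gt0 ?pq_gt0//.
  by have := peetre t y; rewrite (_ : pq (t - y) = pq (y - t))// /pq -sqrrN opprB.
have h3 : ln (2 * pq y * pq (y - t)) = ln 2 + ln (pq y) + ln (pq (y - t)).
  by rewrite !lnM ?posrE ?mulr_gt0 ?pq_gt0.
have h4 : ln (2 * pq t) = ln 2 + ln (pq t) by rewrite lnM ?posrE ?pq_gt0.
by lra.
Qed.

End pearson_likelihood.

(** * Consistency of the maximizer *)

Section consistency.
Context (R : realType) (m theta : R) (d : measure_display)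
  (Omega : measurableType d) (P : probability Omega R) (X : nat -> {RV P >-> R}).
Hypothesis hm : 2^-1 < m.
Hypothesis indepX : mutually_independent P (fun i => (X i : Omega -> R)).
Hypothesis lawX : forall i, has_pvii_law P m theta (X i).
Local Notation mu := (@lebesgue_measure R).

Lemma pvii_total : (\int[mu]_x (pvii_density m (x - theta))%:E = 1)%E.
Proof. by rewrite -(lawX 0%N measurableT) preimage_setT probability_setT. Qed.

Lemma pvii_expectation (h : R -> R) (K : R) i : measurable_fun setT h ->
  (forall x, `|h x| <= K) -> \int[P]_w h (X i w - theta) = pvii_mean m theta h.
Proof.
move=> mh hK; rewrite /pvii_mean /Rintegral; congr fine.
have msh : measurable_fun setT (fun x : R => h (x - theta)).
  by apply: measurableT_comp => //; exact: measurable_funB.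
have mp : measurable_fun setT (fun x : R => pvii_density m (x - theta)).
  exact: continuous_measurable_fun
    (continuous_shift_comp (@continuous_pvii_density _ m)).
pose Y0 : Omega -> measurableTypeR R := X i.
have mY : measurable_fun setT Y0.
  by move=> _ B mB; exact: (@measurable_funPT _ _ _ _ (X i) measurableT B mB).
pose Y := HB.pack_for {mfun Omega >-> measurableTypeR R} Y0
  (isMeasurableFun.Build _ _ _ _ Y0 mY).
rewrite -(@integral_density _ _ (measurableTypeR R) mu (distribution P Y)
  (fun x : R => pvii_density m (x - theta)))//.
- rewrite integral_distribution//; first exact/measurable_EFinP.
  apply: (@bounded_integrable _ _ _ _ (fun w => h (X i w - theta)) K) => //.
  exact: (measurableT_comp msh).
- by move=> x; exact: (pvii_density_ge0 pvii_total).
- by move=> A mA; exact: lawX.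
Qed.

Lemma pvii_slln (h : R -> R) (K : R) : measurable_fun setT h ->
  (forall x, `|h x| <= K) ->
  {ae P, forall w, forall eps, 0 < eps -> \forall n \near \oo,
    `|\sum_(i < n) h (X i w - theta) - n%:R * pvii_mean m theta h| <= eps * n%:R}.
Proof.
move=> mh hK.
apply: (bounded_slln indepX (h := fun x => h (x - theta)) (K := K)) => //.
- by apply: measurableT_comp => //; exact: measurable_funB.
- by move=> i; exact: (pvii_expectation i mh hK).
Qed.

(** The strong law will spend 1/8 of this mass, so that eventually three quarters of the
    observations lie in the interval. *)
Lemma pvii_tight : exists2 A : R, 0 <= A &
  7 / 8 <= pvii_mean m theta (fun y => (`|y| <= A)%R%:R).
Proof.
pose S k := [set w | `|X 0%N w - theta| <= k%:R].
have mY : measurable_fun setT (fun w => `|X 0%N w - theta|).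
  by apply: measurableT_comp => //; exact: measurable_funB.
have mS k : measurable (S k).
  by rewrite -[S k]setTI; apply: measurable_fun_ler.
have US : \bigcup_k S k = setT.
  apply/seteqP; split => // w _; exists (Num.truncn `|X 0%N w - theta|).+1 => //.
  by rewrite /S/= ltW// truncnS_gt.
have ndS : nondecreasing_seq S.
  move=> a b ab; apply/subsetPset => w; rewrite /S/= => /le_trans; apply.
  by rewrite ler_nat.
have := @nondecreasing_cvg_mu _ _ _ P S mS (bigcupT_measurable _ mS) ndS.
rewrite US => cvS.
have [k Sk] : exists k, ((7 / 8 : R)%:E < P (S k))%E.
  apply: contrapT => /forallNP Sle.
  have Snear : \forall k \near \oo, ((7 / 8 : R)%:E >= (P \o S) k)%E.
    by apply: nearW => k /=; rewrite leNgt; exact/negP.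
  have := cvge_le Snear cvS.
  rewrite [X in (X <= _)%E](probability_setT P) lee_fin => h.
  have lt78 : 7 / 8 < 1 :> R by lra.
  have h1 : (1 : R) <= 7 / 8 by apply: h.
  by have := lt_le_trans lt78 h1; rewrite ltxx.
exists k%:R => //.
rewrite -(@pvii_expectation _ 1 0%N).
- rewrite -lee_fin ltW// (lt_le_trans Sk)// (fine_probability P (mS k)) lee_fin.
  rewrite le_eqVlt; apply/orP; left; apply/eqP; apply: eq_Rintegral => w _.
  rewrite indicE; congr (_%:R); congr nat_of_bool.
  by apply/idP/idP => [/set_mem//|h]; exact/mem_set.
- apply: (measurableT_comp (f := fun b : bool => b%:R : R)) => //.
  by apply: measurable_fun_ler => //; exact: measurable_cst.
- by move=> x; rewrite ger0_norm ?ler0n// lern1 leq_b1.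
Qed.

Lemma continuous_mean_log_ratio :
  continuous (fun t => pvii_mean m theta (log_ratio t)).
Proof.
have mL t : measurable_fun setT (@log_ratio R t).
  exact: continuous_measurable_fun (@continuous_log_ratio _ t).
have m1 : measurable_fun setT (fun _ : R => 1 : R) by exact: measurable_cst.
have b1 (y : R) : `|(fun _ : R => 1 : R) y| <= 1 by rewrite normr1.
have lip s t : pvii_mean m theta (log_ratio s) - pvii_mean m theta (log_ratio t) <=
    2 * `|s - t| + (s - t) ^+ 2.
  set c := 2 * _ + _.
  rewrite lerBlDl.
  have := pvii_mean_lin pvii_total 1 c (mL t) m1 (normr_log_ratio t) b1.
  rewrite (pvii_mean1 pvii_total) mul1r mulr1 => <-.
  pose f1 y := 1 * log_ratio t y + c.
  have mf1 : measurable_fun setT f1.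
    by apply: measurable_funD => //; exact: measurable_funM.
  have bf1 y : `|f1 y| <= ln (2 * pq t) + `|c|.
    rewrite /f1 mul1r (le_trans (ler_normD _ _))// lerD2r.
    exact: normr_log_ratio.
  apply: le_Rintegral => //.
  - exact: (integrable_pvii_mean pvii_total (mL s) (normr_log_ratio s)).
  - exact: (integrable_pvii_mean pvii_total mf1 bf1).
  - move=> x _; rewrite ler_wpM2r ?(pvii_density_ge0 pvii_total)//.
    have := log_ratio_lipschitz s t (x - theta); rewrite -/c.
    by clear b1; lra.
move=> t; apply/cvgrPdist_le => e e0.
near=> s.
have st : `|t - s| <= Num.min 1 (e / 3).
  near: s; apply: cvgr_dist_le; first exact: cvg_id.
  by rewrite lt_min ltr01 divr_gt0.
move: st; rewrite le_min => /andP[st1 ste].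
have sq : (t - s) ^+ 2 <= `|t - s|.
  by rewrite -real_normK ?num_real// expr2 ler_piMr.
have := lip t s; have := lip s t; rewrite [`|s - t|]distrC -sqrrN opprB.
clear b1 lip => h1 h2.
by rewrite ler_norml; apply/andP; split; lra.
Unshelve. all: by end_near. Qed.

Lemma mean_log_ratio_lower_bound (eps T : R) : 0 < eps -> eps <= T ->
  exists2 delta, 0 < delta & forall t, eps <= `|t| <= T ->
    delta <= pvii_mean m theta (log_ratio t).
Proof.
move=> e0 eT.
have cG := continuous_subspaceT (A := `[eps, T]) continuous_mean_log_ratio.
have cG' := continuous_subspaceT (A := `[- T, - eps]) continuous_mean_log_ratio.
have [c1 c1I c1min] := EVT_min eT cG.
have eT' : - T <= - eps by rewrite lerN2.
have [c2 c2I c2min] := EVT_min eT' cG'.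
exists (Num.min (pvii_mean m theta (log_ratio c1)) (pvii_mean m theta (log_ratio c2))).
  rewrite lt_min; apply/andP; split; apply: (pvii_mean_log_ratio_gt0 hm pvii_total).
    by move: c1I; rewrite in_itv/= => /andP[h _]; rewrite gt_eqF// (lt_le_trans e0).
  move: c2I; rewrite in_itv/= => /andP[_ h]; rewrite lt_eqF// (le_lt_trans h)//.
  by rewrite oppr_lt0.
move=> t; rewrite ge_min; have [t0|t0] := leP 0 t.
  by rewrite ger0_norm// => tI; rewrite c1min// in_itv.
rewrite ltr0_norm// => /andP[h1 h2]; rewrite c2min ?orbT// in_itv/=.
by rewrite lerNl h2 lerNr.
Qed.

End consistency.

Lemma near_forall_ltn (Q : nat -> nat -> Prop) (J : nat) :
  (forall j, \forall n \near \oo, Q j n) ->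
  \forall n \near \oo, forall j, (j < J)%N -> Q j n.
Proof.
move=> HQ; elim: J => [|J ih]; first exact: nearW.
move: ih (HQ J); apply: filterS2 => n h1 h2 j.
by rewrite ltnS leq_eqVlt => /predU1P[->//|]; exact: h1.
Qed.

Section consistency_theorem.
Context (R : realType) (m theta : R) (d : measure_display)
  (Omega : measurableType d) (P : probability Omega R) (X : nat -> {RV P >-> R}).
Hypothesis hm : 2^-1 < m.
Hypothesis indepX : mutually_independent P (fun i => (X i : Omega -> R)).
Hypothesis lawX : forall i, has_pvii_law P m theta (X i).

(** With $B = \ln(2(1 + t^2))$, at least three quarters of the terms are no less than $B - C$ and
    the others no less than $-B$. The sum is at least $n(B/2 - 3C/4)$, and the condition on [t]
    gives $B > 2C$. *)
Lemma sum_log_ratio_tail_gt0 (y : nat -> R) (n : nat) (A t : R) :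
  (0 < n)%N -> 0 <= A ->
  3 / 4 * n%:R <= \sum_(i < n) ((`|y i| <= A)%R%:R : R) ->
  expR (2 * (2 * ln 2 + 2 * ln (pq A))) < `|t| ->
  0 < \sum_(i < n) log_ratio t (y i).
Proof.
move=> n0 A0; set C := 2 * ln 2 + 2 * ln (pq A); set N := \sum_(i < n) _ => HN Ht.
set B := ln (2 * pq t).
have n0R : 0 < n%:R :> R by rewrite ltr0n.
have C0 : 0 <= C by rewrite addr_ge0// mulr_ge0// ln_ge0 ?pq_ge1// ler1n.
have BC : 2 * C < B.
  rewrite -[ltLHS]expRK ltr_ln ?posrE ?expR_gt0 ?mulr_gt0 ?pq_gt0//.
  rewrite (lt_le_trans Ht)// /pq -[t ^+ 2]real_normK ?num_real//.
  by have := sqr_ge0 (`|t| - 1); nra.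
have lowB : \sum_(i < n) ((2 * B - C) * (`|y i| <= A)%R%:R - B) <=
    \sum_(i < n) log_ratio t (y i).
  apply: ler_sum => i _; have [yA|yA] := leP `|y i| A.
    by have := log_ratio_tail t A0 yA; rewrite -/B -/C mulr1; lra.
  have := normr_log_ratio t (y i); rewrite ler_norml -/B => /andP[h _].
  by rewrite mulr0 sub0r.
apply: lt_le_trans lowB.
rewrite sumrB -mulr_sumr -/N sumr_const card_ord -mulr_natl.
have h1 : (2 * B - C) * (3 / 4 * n%:R) <= (2 * B - C) * N.
  by rewrite ler_wpM2l//; lra.
have h2 : 2 * C * n%:R < B * n%:R by rewrite ltr_pM2r.
have h3 : 0 <= C * n%:R by rewrite mulr_ge0// ltW.
by move: h1 h2 h3; clearbody N; lra.
Qed.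

Lemma grid_point (T h t : R) : 0 < h -> `|t| <= T ->
  exists j : nat, [/\ (j < (Num.truncn (2 * T / h)).+1)%N,
    - T + j%:R * h <= t & t - (- T + j%:R * h) <= h].
Proof.
move=> h0; rewrite ler_norml => /andP[tT1 tT2].
have q0 : 0 <= (t + T) / h by rewrite divr_ge0 ?(ltW h0)//; lra.
have /andP[j1 j2] := truncn_itv q0.
exists (Num.truncn ((t + T) / h)); split.
- by rewrite ltnS; apply: le_truncn; rewrite ler_pM2r ?invr_gt0//; lra.
- by move: j1; rewrite ler_pdivlMr//; lra.
- by move: j2; rewrite ltr_pdivrMr// -natr1 mulrDl mul1r; lra.
Qed.

Lemma pvii_consistency (tau : nat -> Omega -> R) :
  (forall n w t, (0 < n)%N -> \sum_(i < n) log_ratio (tau n w) (X i w - theta) <=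
    \sum_(i < n) log_ratio t (X i w - theta)) ->
  {ae P, forall w, forall eps, 0 < eps -> \forall n \near \oo, `|tau n w| <= eps}.
Proof.
move=> hmin.
have p_total := pvii_total lawX.
have tau_le0 n w : (0 < n)%N -> \sum_(i < n) log_ratio (tau n w) (X i w - theta) <= 0.
  move=> n0; rewrite (le_trans (hmin n w 0 n0))//.
  by rewrite big1// => i _; rewrite /log_ratio subr0 subrr.
have [A A0 hA] := pvii_tight lawX.
pose T := expR (2 * (2 * ln 2 + 2 * ln (pq A))) + 1.
have T1 : 1 <= T by rewrite lerDr expR_ge0.
have TE : expR (2 * (2 * ln 2 + 2 * ln (pq A))) < T by rewrite ltrDl.
clearbody T.
suff Hk k : {ae P, forall w, \forall n \near \oo, `|tau n w| <= k.+1%:R^-1}.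
  have := ae_foralln Hk; apply: filterS => w Hw eps e0.
  pose k := Num.truncn eps^-1.
  apply: filterS (Hw k) => n /le_trans; apply.
  rewrite -[leRHS]invrK lef_pV2 ?posrE ?invr_gt0//.
  by rewrite ltW// truncnS_gt.
pose e : R := k.+1%:R^-1.
have e0 : 0 < e by rewrite invr_gt0.
have e1 : e <= 1 by rewrite invf_le1// ler1n.
rewrite -/e; clearbody e.
have eT : e / 2 <= T by lra.
have e20 : 0 < e / 2 by lra.
have [delta delta0 Hdelta] := mean_log_ratio_lower_bound hm lawX e20 eT.
(* The bound [e / 2] keeps the grid point away from 0; the bounds 1 and [delta / 9] limit the change
   of [log_ratio] to $3h \le \delta/3$. With another $\delta/3$ spent on the strong law, the sum at
   the maximizer would be at least $n\delta/3$, yet it is at most 0. *)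
pose h := Num.min (e / 2) (Num.min 1 (delta / 9)).
have h0 : 0 < h by rewrite !lt_min e20 ltr01 divr_gt0.
have : h <= h by [].
rewrite {2}/h !le_min => /and3P[he h1 hdelta].
clearbody h.
pose g j : R := - T + j%:R * h.
have mL t : measurable_fun setT (@log_ratio R t).
  exact: continuous_measurable_fun (@continuous_log_ratio _ t).
have slln_g : {ae P, forall w, forall j eps, 0 < eps -> \forall n \near \oo,
    `|\sum_(i < n) log_ratio (g j) (X i w - theta) -
      n%:R * pvii_mean m theta (log_ratio (g j))| <= eps * n%:R}.
  apply: ae_foralln => j.
  exact: (pvii_slln indepX lawX (mL (g j)) (normr_log_ratio (g j))).
have mA : measurable_fun setT (fun y : R => (`|y| <= A)%R%:R : R).
  apply: (measurableT_comp (f := fun b : bool => b%:R : R)) => //.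
  by apply: measurable_fun_ler => //; exact: measurable_cst.
have bA (y : R) : `|(`|y| <= A)%R%:R : R| <= 1.
  by rewrite ger0_norm ?ler0n// lern1 leq_b1.
have slln_A := pvii_slln indepX lawX mA bA.
move: slln_g slln_A; apply: filterS2 => w Hg HA.
have d30 : 0 < delta / 3 by rewrite divr_gt0.
have Hgrid := near_forall_ltn (Num.truncn (2 * T / h)).+1
  (fun j => Hg j (delta / 3) d30).
have e80 : 0 < 8^-1 :> R by rewrite invr_gt0.
move: Hgrid (HA _ e80) (nbhs_infty_gt 0); apply: filterS3 => n {}Hgrid {}HA n0.
have n0R : 0 < n%:R :> R by rewrite ltr0n.
rewrite leNgt; apply/negP => et.
set t := tau n w in et.
have [tT|Tt] := leP `|t| T; last first.
  have HN : 3 / 4 * n%:R <= \sum_(i < n) ((`|X i w - theta| <= A)%R%:R : R).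
    have := ler_wpM2l (ltW n0R) hA.
    by move: HA; rewrite ler_norml => /andP[HA _]; lra.
  have := @sum_log_ratio_tail_gt0 (fun i => X i w - theta) _ _ _ n0 A0 HN (lt_trans TE Tt).
  by rewrite ltNge tau_le0.
have [j [jJ gt tg]] := grid_point h0 tT.
rewrite -/(g j) in gt tg.
have gd : `|t - g j| <= h by rewrite ger0_norm ?subr_ge0.
have gI : e / 2 <= `|g j| <= T.
  apply/andP; split.
    have := ler_normD (t - g j) (g j); rewrite subrK => hh.
    by lra.
  rewrite ler_norml; move: tT; rewrite ler_norml => /andP[_ tT].
  apply/andP; split; last exact: le_trans tT.
  by rewrite /g lerDl mulr_ge0// ltW.
have Gd := Hdelta _ gI.
have := Hgrid j jJ; rewrite ler_norml => /andP[low _].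
have diff : \sum_(i < n) log_ratio (g j) (X i w - theta) -
    \sum_(i < n) log_ratio t (X i w - theta) <= n%:R * (3 * h).
  rewrite -sumrB mulr_natl -[X in _ *+ X](card_ord n) -sumr_const.
  apply: ler_sum => i _; apply: (le_trans (log_ratio_lipschitz _ _ _)).
  rewrite distrC; have gd2 : (g j - t) ^+ 2 <= h.
    rewrite -sqrrN opprB -real_normK ?num_real// expr2.
    by rewrite (le_trans _ gd)// ler_piMr// (le_trans gd).
  by lra.
have tl := tau_le0 n w n0; rewrite -/t in tl.
have p1 : n%:R * delta <= n%:R * pvii_mean m theta (log_ratio (g j)).
  by rewrite ler_pM2l.
have p2 : n%:R * h <= n%:R * (delta / 9) by rewrite ler_pM2l.
have p3 : 0 < n%:R * delta by rewrite mulr_gt0.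
move: low diff tl p1 p2 p3.
set S1 := \sum_(i < n) _; set S2 := \sum_(i < n) _; set G := pvii_mean _ _ _.
by clear; nra.
Qed.

End consistency_theorem.

Lemma limn_esup_eq (R : realType) (u : nat -> R) (s : R) :
  (forall e, 0 < e -> \forall n \near \oo, u n <= s + e) ->
  (forall e, 0 < e -> forall N, exists2 n, (N <= n)%N & s - e <= u n) ->
  limn_esup (fun n => (u n)%:E) = s%:E.
Proof.
move=> hub hlb; rewrite limn_esup_lim; apply/eqP; rewrite eq_le; apply/andP; split.
  apply/lee_addgt0Pr => e e0; rewrite -EFinD.
  apply: lime_le; first exact: is_cvg_esups.
  have [N _ HN] := hub e e0; exists N => // n /= Nn.
  by apply: ge_ereal_sup => _ /= [k nk <-]; rewrite lee_fin; exact: HN (leq_trans Nn nk).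
apply/lee_addgt0Pr => e e0; rewrite -leeBlDr// -EFinB.
apply: lime_ge; first exact: is_cvg_esups.
apply: nearW => n; have [k nk hk] := hlb e e0 n.
apply: (@le_trans _ _ (u k)%:E); first by rewrite lee_fin.
by apply: ereal_sup_ubound; exists k.
Qed.

(** * From the score to the estimator *)

Section score_expansion.
Context (R : realType) (tau D S J : R) (n : nat).
Hypotheses (n0 : (0 < n)%N) (lln0 : 0 < ln (ln n%:R : R)).
Hypothesis expansion : `|tau * D - S| <= 3 * n%:R * tau ^+ 2.

Let n0R : 0 < n%:R :> R. Proof. by rewrite ltr0n. Qed.

Let ratio_sqrt : Num.sqrt (n%:R / ln (ln n%:R)) * Num.sqrt (n%:R * ln (ln n%:R)) = n%:R :> R.
Proof.
rewrite -sqrtrM ?divr_ge0 ?(ltW n0R) ?(ltW lln0)//.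
rewrite (_ : _ / _ * _ = n%:R ^+ 2); last by field; rewrite gt_eqF.
by rewrite sqrtr_sqr ger0_norm ?(ltW n0R).
Qed.

(** For [tau > 0] the quadratic error is at most $3\eta n\tau$, and the slope is off by at most
    $\eta n$: together these give $4\eta$. For [tau <= 0] the bound is trivial. *)
Lemma score_expansion_le (c eta : R) : 0 <= c -> 4 * eta < J -> `|tau| <= eta ->
  `|D - n%:R * J| <= eta * n%:R ->
  S <= c * Num.sqrt (n%:R * ln (ln n%:R)) ->
  Num.sqrt (n%:R / ln (ln n%:R)) * tau <= c / (J - 4 * eta).
Proof.
move=> c0 eJ te De Sc.
have J0 : 0 < J - 4 * eta by rewrite subr_gt0.
have [t0|t0] := leP tau 0.
  rewrite (@le_trans _ _ 0)// ?mulr_ge0_le0 ?sqrtr_ge0//.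
  by rewrite divr_ge0// ltW.
rewrite ler_pdivlMr// -(ler_pM2r n0R).
have tE : tau <= eta by rewrite (le_trans (ler_norm _)).
have h1 : tau * (n%:R * (J - 4 * eta)) <= S.
  move: expansion De; rewrite !ler_norml => /andP[_ h] /andP[h' _].
  have k1 : tau * (n%:R * J - eta * n%:R) <= tau * D.
    by rewrite ler_pM2l//; lra.
  have k2 : n%:R * tau ^+ 2 <= n%:R * (tau * eta).
    by rewrite ler_pM2l// expr2 ler_pM2l.
  by lra.
have h2 := ler_wpM2l (sqrtr_ge0 (n%:R / ln (ln n%:R))) (le_trans h1 Sc).
rewrite -mulrA -mulrA [(J - _) * _]mulrC (le_trans h2)//.
by rewrite mulrCA ratio_sqrt.
Qed.

(** The sign of [tau] comes from $S > 0$, since $S \le \tau(D + 3n\tau)$ with a positive second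
    factor. *)
Lemma score_expansion_ge (c eta : R) : 0 < c -> 4 * eta < J -> `|tau| <= eta ->
  `|D - n%:R * J| <= eta * n%:R ->
  c * Num.sqrt (n%:R * ln (ln n%:R)) <= S ->
  c / (J + 4 * eta) <= Num.sqrt (n%:R / ln (ln n%:R)) * tau.
Proof.
move=> c0 eJ te De Sc.
have e0 : 0 <= eta by exact: le_trans te.
have J0 : 0 < J + 4 * eta by lra.
have S0 : 0 < S.
  by rewrite (lt_le_trans _ Sc)// mulr_gt0// sqrtr_gt0 mulr_gt0.
move: te; rewrite ler_norml => /andP[te1 te2].
have D1 : n%:R * (J - 4 * eta) <= D + 3 * n%:R * tau.
  move: De; rewrite ler_norml => /andP[h _].
  have : n%:R * (- eta) <= n%:R * tau by rewrite ler_pM2l.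
  by lra.
have D2 : D + 3 * n%:R * tau <= n%:R * (J + 4 * eta).
  move: De; rewrite ler_norml => /andP[_ h].
  have : n%:R * tau <= n%:R * eta by rewrite ler_pM2l.
  by lra.
have D0 : 0 < D + 3 * n%:R * tau.
  by apply: lt_le_trans D1; rewrite mulr_gt0// subr_gt0.
have ST : S <= tau * (D + 3 * n%:R * tau).
  by move: expansion; rewrite ler_norml => /andP[h _]; lra.
have t0 : 0 < tau by rewrite -(pmulr_lgt0 _ D0) (lt_le_trans S0).
rewrite ler_pdivrMr// -(ler_pM2r n0R).
have h1 : S <= tau * (n%:R * (J + 4 * eta)).
  by apply: (le_trans ST); rewrite ler_pM2l.
have h2 := ler_wpM2l (sqrtr_ge0 (n%:R / ln (ln n%:R))) (le_trans Sc h1).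
rewrite -mulrA -mulrA [(J + _) * _]mulrC; apply: le_trans h2.
by rewrite mulrCA ratio_sqrt.
Qed.

End score_expansion.

Lemma likelihood_maximizer (R : realType) (m : R) n (x : n.-tuple R) (s t : R) :
  0 < m -> 0 < pvii_const m ->
  pvii_likelihood m x t <= pvii_likelihood m x s ->
  \sum_(i < n) ln (pq (tnth x i - s)) <= \sum_(i < n) ln (pq (tnth x i - t)).
Proof.
move=> m0 c0.
have likE r : pvii_likelihood m x r =
    expR (\sum_(i < n) (ln (pvii_const m) - m * ln (pq (tnth x i - r)))).
  rewrite expR_sum; apply: eq_bigr => i _.
  rewrite pvii_densityE powR_expR ?pq_gt0// expRD lnK ?posrE//.
  by rewrite mulNr.
rewrite !likE ler_expR !sumrB lerD2l lerN2 -!mulr_sumr.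
by rewrite ler_pM2l.
Qed.

Theorem theorem1p3 (R : realType) (m : R) (hm : 2^-1 < m)
  (d : measure_display) (Omega : measurableType d) (P : probability Omega R)
  (X : nat -> {RV P >-> R})
  (hindep : mutually_independent P (fun i => (X i : Omega -> R)))
  (thetahat : forall n : nat, n.-tuple R -> R)
  (hmeas : forall n : nat, (0 < n)%N -> measurable_fun setT (thetahat n))
  (hmle : forall (n : nat) (x : n.-tuple R) (t : R), (0 < n)%N ->
     pvii_likelihood m x t <= pvii_likelihood m x (thetahat n x)) :
  forall theta : R,
  (forall i, has_pvii_law P m theta (X i)) ->
  {ae P, forall w : Omega,
     limn_esup (fun n : nat =>
       (Num.sqrt (n%:R / ln (ln n%:R)) *
          (thetahat n [tuple X (nat_of_ord i) w | i < n] - theta))%:E)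
     = (Num.sqrt (2 * (m + 1) / (m * (2 * m - 1))))%:E}.
Proof.
move=> theta lawX.
have m0 : 0 < m by apply: lt_trans hm; rewrite invr_gt0.
have m21 : 0 < 2 * m - 1 by lra.
have p_total := pvii_total lawX.
pose tau n w := thetahat n [tuple X (nat_of_ord i) w | i < n] - theta.
have sub_tau n i w : X i w - thetahat n [tuple X (nat_of_ord j) w | j < n] =
    X i w - theta - tau n w by rewrite /tau; ring.
have tau_min n w t : (0 < n)%N ->
    \sum_(i < n) ln (pq (X i w - theta - tau n w)) <=
    \sum_(i < n) ln (pq (X i w - theta - t)).
  move=> n0.
  have := likelihood_maximizer m0 (pvii_const_gt0 p_total)
    (hmle n [tuple X (nat_of_ord i) w | i < n] (theta + t) n0).
  under eq_bigr do rewrite tnth_mktuple sub_tau.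
  by under [X in _ <= X -> _]eq_bigr do rewrite tnth_mktuple opprD addrA.
have consistent : {ae P, forall w, forall eps, 0 < eps ->
    \forall n \near \oo, `|tau n w| <= eps}.
  apply: (pvii_consistency hm hindep lawX) => n w t n0.
  by rewrite /log_ratio !sumrB lerD2r tau_min.
have mphi : measurable_fun setT (@pphi R).
  exact: continuous_measurable_fun (@continuous_pphi R).
have mdphi : measurable_fun setT (@dpphi R).
  exact: continuous_measurable_fun (@continuous_dpphi R).
have mpsi : measurable_fun setT (fun x : R => pphi (x - theta)).
  by apply: measurableT_comp => //; exact: measurable_funB.
have psi1 (x : R) : `|pphi (x - theta)| <= 1 by exact: normr_pphi.
have psi_mean i : \int[P]_w pphi (X i w - theta) = 0.
  rewrite (pvii_expectation lawX i mphi (@normr_pphi R)).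
  exact: pvii_mean_pphi.
pose V := (2 * m - 1) / (4 * m * (m + 1)).
have m10 : 0 < m + 1 by rewrite ltr_wpDl// ltW.
have V0 : 0 < V by rewrite divr_gt0// !mulr_gt0.
have psi_var i : \int[P]_w (pphi (X i w - theta) ^+ 2) = V.
  rewrite (@pvii_expectation _ _ _ _ _ _ _ lawX (fun y => pphi y ^+ 2) 1 i).
  - exact: pvii_mean_pphi2.
  - exact: measurable_funX.
  - by move=> x; rewrite normrX exprn_ile1 ?normr_pphi.
have psi_var_le i : \int[P]_w (pphi (X i w - theta) ^+ 2) <= V by rewrite psi_var.
pose J := 2 * m * V.
have J0 : 0 < J by rewrite mulr_gt0// mulr_gt0.
have JE : pvii_mean m theta (@dpphi R) = J.
  by rewrite (pvii_mean_dpphi hm p_total) (pvii_mean_pphi2 hm p_total).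
pose sigma := Num.sqrt (2 * V).
have V20 : 0 < 2 * V by rewrite mulr_gt0.
have sigma0 : 0 < sigma by rewrite sqrtr_gt0.
have sigma2 : sigma ^+ 2 = 2 * V by rewrite sqr_sqrtr// ltW.
have -> : Num.sqrt (2 * (m + 1) / (m * (2 * m - 1))) = sigma / J.
  rewrite -[RHS]ger0_norm ?divr_ge0 ?(ltW sigma0) ?(ltW J0)// -sqrtr_sqr.
  congr Num.sqrt; rewrite exprMn sigma2 exprVn /J /V; field.
  by rewrite !gt_eqF.
(* Countably many margins, so that one null set serves all. With $\eta = J\kappa/4$ the slopes $J
   \mp 4\eta$ become $J(1 \mp \kappa)$. Starting at 1/2 ensures $(1 + \kappa)/(1 - \kappa) \le 1 +
   4\kappa$; the bound $(1 - \kappa)/(1 + \kappa) \ge 1 - 4\kappa$ matches it from below. *)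
pose kappa k : R := k.+2%:R^-1.
have kappa0 k : 0 < kappa k by rewrite invr_gt0.
have kappa1 k : kappa k <= 2^-1 by rewrite lef_pV2 ?posrE// ler_nat.
have upper : {ae P, forall w, forall k, \forall n \near \oo,
    \sum_(i < n) pphi (X i w - theta) <=
    sigma * (1 + kappa k) * Num.sqrt (n%:R * ln (ln n%:R))}.
  apply: ae_foralln => k; apply: (upper_lil hindep mpsi psi1 ltr01 psi_mean psi_var_le).
    by rewrite mulr_gt0// addr_gt0.
  rewrite exprMn sigma2 ltr_pMr// exprn_egt1// ltrDl//.
have lower : {ae P, forall w, forall k N, exists2 n, (N <= n)%N &
    sigma * (1 - kappa k) * Num.sqrt (n%:R * ln (ln n%:R)) <=
    \sum_(i < n) pphi (X i w - theta)}.
  have k1 k : 0 < 1 - kappa k by have := kappa1 k; lra.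
  apply: ae_foralln => k.
  apply: (lower_lil hindep mpsi psi1 ltr01 psi_mean psi_var V0).
    by rewrite mulr_gt0.
  rewrite exprMn sigma2 gtr_pMr// exprn_ilt1//; first exact: ltW.
  by rewrite ltrBlDr ltrDl.
have curvature := pvii_slln hindep lawX mdphi (@normr_dpphi R).
rewrite JE in curvature.
have lln_ev : \forall n \near \oo, 0 < ln (ln n%:R : R).
  near=> n.
  have n1 : expR (expR 1) <= n%:R :> R by near: n; exact: nbhs_infty_ger.
  have n0 : 0 < n%:R :> R by rewrite (lt_le_trans (expR_gt0 _) n1).
  have l1 : expR 1 <= ln n%:R :> R.
    by rewrite -[leLHS]expRK ler_ln ?posrE ?expR_gt0.
  by rewrite ln_gt0// (lt_le_trans _ l1)// expR_gt1.
have expansion n w : (0 < n)%N ->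
    `|tau n w * \sum_(i < n) dpphi (X i w - theta) -
      \sum_(i < n) pphi (X i w - theta)| <= 3 * n%:R * tau n w ^+ 2.
  move=> n0; have score : \sum_(i < n) pphi (X i w - theta - tau n w) = 0
    := @minimizer_score _ (fun i => X i w - theta) _ _ (tau_min n w ^~ n0).
  have -> : tau n w * \sum_(i < n) dpphi (X i w - theta) -
      \sum_(i < n) pphi (X i w - theta) =
      \sum_(i < n) (pphi (X i w - theta - tau n w) - pphi (X i w - theta) +
        tau n w * dpphi (X i w - theta)).
    by rewrite [RHS]big_split/= [X in _ = X + _]sumrB score sub0r mulr_sumr addrC.
  rewrite (le_trans (ler_norm_sum _ _ _))//.
  rewrite (le_trans (ler_sum _ (fun i _ => pphi_taylor _ _)))//.
  by rewrite sumr_const card_ord -[_ *+ n]mulr_natl mulrA [_ * 3]mulrC.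
have s0 : 0 < sigma / J by rewrite divr_gt0.
have J4 k : 4 * (J * kappa k / 4) < J.
  by have := kappa1 k; have := ler_wpM2l (ltW J0) (kappa1 k); lra.
have eta0 k : 0 < J * kappa k / 4 by rewrite divr_gt0// mulr_gt0.
have all_k (e : R) : 0 < e -> exists k, sigma / J * (4 * kappa k) <= e.
  move=> e0; pose k := Num.truncn (sigma / J * 4 / e); exists k.
  rewrite mulrA ler_pdivrMr// [e * _]mulrC -ler_pdivrMr// ltW//.
  by rewrite (lt_trans (truncnS_gt _))// ltr_nat.
have up_lo : {ae P, forall w, (forall k, \forall n \near \oo,
    Num.sqrt (n%:R / ln (ln n%:R)) * tau n w <= sigma / J * (1 + 4 * kappa k)) /\
    forall k N, exists2 n, (N <= n)%N & sigma / J * (1 - 4 * kappa k) <=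
      Num.sqrt (n%:R / ln (ln n%:R)) * tau n w}.
  have both : {ae P, forall w, (forall eps, 0 < eps ->
      \forall n \near \oo, `|tau n w| <= eps) /\ forall eps, 0 < eps ->
      \forall n \near \oo, `|\sum_(i < n) dpphi (X i w - theta) - n%:R * J| <= eps * n%:R}.
    by move: consistent curvature; apply: filterS2 => w h1 h2; split.
  move: both upper lower; apply: filterS3 => w [taus curv] up lo; split.
    move=> k; have e0 := eta0 k.
    near=> n.
    have n0 : (0 < n)%N by near: n; exact: nbhs_infty_gt.
    have lln0 : 0 < ln (ln n%:R) :> R by near: n; exact: lln_ev.
    have te : `|tau n w| <= J * kappa k / 4 by near: n; exact: taus.
    have ce : `|\sum_(i < n) dpphi (X i w - theta) - n%:R * J| <= J * kappa k / 4 * n%:R.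
      by near: n; exact: curv.
    have Se : \sum_(i < n) pphi (X i w - theta) <=
        sigma * (1 + kappa k) * Num.sqrt (n%:R * ln (ln n%:R)) by near: n; exact: up.
    have c0 : 0 <= sigma * (1 + kappa k) by rewrite mulr_ge0 ?(ltW sigma0)// addr_ge0// ltW.
    apply: le_trans (score_expansion_le n0 lln0 (expansion n w n0) c0 (J4 k) te ce Se) _.
    have K0 := kappa0 k; have K1 := kappa1 k.
    have -> : J - 4 * (J * kappa k / 4) = J * (1 - kappa k) by field.
    have k1 : 0 < 1 - kappa k by lra.
    rewrite invfM mulrACA ler_pM2l// ler_pdivrMr//.
    have : kappa k * kappa k <= kappa k * 2^-1 by rewrite ler_pM2l.
    by lra.
  move=> k N; have e0 := eta0 k.
  have near_k : \forall n \near \oo, [/\ (0 < n)%N, 0 < ln (ln n%:R) :> R,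
      `|tau n w| <= J * kappa k / 4 &
      `|\sum_(i < n) dpphi (X i w - theta) - n%:R * J| <= J * kappa k / 4 * n%:R].
    near=> n; split; near: n; [exact: nbhs_infty_gt|exact: lln_ev|exact: taus|exact: curv].
  have [N1 _ HN1] := near_k.
  have [n nN Sn] := lo k (maxn N N1).
  move: nN; rewrite geq_max => /andP[Nn N1n]; exists n => //.
  have [n0 lln0 te ce] := HN1 n N1n.
  have K0 := kappa0 k; have K1 := kappa1 k.
  have c0 : 0 < sigma * (1 - kappa k) by rewrite mulr_gt0// subr_gt0; lra.
  apply: le_trans (score_expansion_ge n0 lln0 (expansion n w n0) c0 (J4 k) te ce Sn).
  have -> : J + 4 * (J * kappa k / 4) = J * (1 + kappa k) by field.
  rewrite [(J * _)^-1]invfM mulrACA ler_pM2l// ler_pdivlMr ?addr_gt0//.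
  have : 0 < kappa k * kappa k by rewrite mulr_gt0.
  by lra.
move: up_lo; apply: filterS => w [up lo].
apply: limn_esup_eq => e e0; have [k hk] := all_k e e0.
  apply: filterS (up k) => n /le_trans; apply.
  by rewrite mulrDr mulr1 lerD2l.
move=> N; have [n Nn hn] := lo k N; exists n => //.
apply: le_trans hn; rewrite mulrBr mulr1 lerD2l lerN2//.
Unshelve. all: by end_near. Qed.
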